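(* Let $Q$ be a countable directed graph, let $\pi$ be a multiplicative linear functional on $\mathcal{T}^{+}(Q)$, and let $D:\mathcal{T}^{+}(Q)\to\mathbb{C}$ be a continuous derivation at $\pi$. Then there exists $n$ with $0<n\le\infty$ such that $D$ factors continuously through $A_n$.
   Context: A directed graph $Q$ has vertex set $V(Q)$, edge set $E(Q)$, and range and source maps $r,s:E(Q)\to V(Q)$. A finite path is a sequence $e_1e_2\cdots e_n$ of edges with $r(e_i)=s(e_{i-1})$ for $2\le i\le n$; vertices are paths of length $0$. $\mathcal{T}^{+}(Q)$ is the norm closed operator algebra generated by the left regular representation of $Q$: on the Hilbert space with orthonormal basis $\{\xi_u\}$ indexed by all finite paths $u$ (including vertices), $L_e\xi_u=\xi_{eu}$ if $r(u)=s(e)$ and $0$ otherwise, and $P_v\xi_u=\xi_u$ if $r(u)=v$ and $0$ otherwise; $\mathcal{T}^{+}(Q)$ is generated by $\{P_v,L_e\}$. $A_n:=\mathcal{T}^{+}(B_n)$, where $B_n$ is the directed graph with one vertex and $n$ edges (countably infinitely many if $n=\infty$). A multiplicative linear functional is a nonzero homomorphism into $\mathbb{C}$. Given a completely contractive homomorphism $\pi:A\to B$, a derivation at $\pi$ is a continuous linear map $D:A\to B$ with $D(ab)=D(a)\pi(b)+\pi(a)D(b)$ for all $a,b\in A$. $D$ factors continuously through an operator algebra $C$ if there are completely contractive homomorphisms $\iota:A\to C$ and $\tilde\pi:C\to B$ with $\pi=\tilde\pi\circ\iota$ and a continuous derivation $\tilde D:C\to B$ at $\tilde\pi$ with $D=\tilde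 D\circ\iota$. *)

(* Defs.v *)
From HB Require Import structures.
From mathcomp Require Import all_boot all_order all_algebra.
From mathcomp Require Import all_classical all_reals all_analysis.
From mathcomp Require Import complex.
From mathcomp Require Import ring lra.

Set Implicit Arguments.
Unset Strict Implicit.
Unset Printing Implicit Defensive.
Import Order.TTheory GRing.Theory Num.Theory.
Import numFieldNormedType.Exports.
Local Open Scope classical_set_scope.
Local Open Scope ring_scope.
Local Open Scope complex_scope.

Notation normc := ComplexField.Normc.normc.

Section Ell2.
Variables (R : realType) (X : choiceType).
Implicit Types f g : X -> R[i].

Definition sqsum f : \bar R := \esum_(x in setT) (normc (f x) ^+ 2)%:E.

Definition sqsummable : {pred X -> R[i]} :=
  fun f => `[< (sqsum f < +oo)%E >].

Lemma normc_ge0 (z : R[i]) : 0 <= normc z.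
Proof. by case: z => a b; exact: sqrtr_ge0. Qed.

Lemma normc_triangle (a b : R[i]) : normc (a + b) <= normc a + normc b.
Proof. by rewrite -lecR rmorphD; exact: (@ler_normD _ R[i]). Qed.

Lemma sqsum_ge0 f : (0 <= sqsum f)%E.
Proof. by apply: esum_ge0 => x _; rewrite lee_fin sqr_ge0. Qed.

Lemma le_esumZ (c : R) (a : X -> R) : 0 <= c -> (forall x, 0 <= a x) ->
  (\esum_(x in setT) (c * a x)%:E <= c%:E * \esum_(x in setT) (a x)%:E)%E.
Proof.
move=> c0 a0; apply: ge_ereal_sup => _ [A [Afin AX] <-].
under eq_fsbigr do rewrite EFinM.
rewrite -ge0_mule_fsumr; last by move=> i; rewrite lee_fin.
by rewrite lee_wpmul2l ?lee_fin//; apply: esum_ge; exists A.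
Qed.

Lemma sqsumZ_le (c : R[i]) f :
  (sqsum (c *: f)%R <= (normc c ^+ 2)%:E * sqsum f)%E.
Proof.
apply: le_trans (@le_esumZ _ (fun x => normc (f x) ^+ 2) _ _).
- by apply: le_esum => x _; rewrite lee_fin ComplexField.Normc.normcM exprMn.
- exact: sqr_ge0.
- by move=> x; exact: sqr_ge0.
Qed.

Lemma sqsumD_le f g (t : R) : 0 < t ->
  (sqsum (f + g)%R <= (1 + t)%:E * sqsum f + (1 + t^-1)%:E * sqsum g)%E.
Proof.
move=> t0; have ti0 : 0 < t^-1 by rewrite invr_gt0.
pose a x := (1 + t) * normc (f x) ^+ 2; pose b x := (1 + t^-1) * normc (g x) ^+ 2.
have a0 x : 0 <= a x by rewrite mulr_ge0 ?sqr_ge0// addr_ge0// ltW.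
have b0 x : 0 <= b x by rewrite mulr_ge0 ?sqr_ge0// addr_ge0// ltW.
apply: (@le_trans _ _ (\esum_(x in setT) ((a x)%:E + (b x)%:E))%E).
  apply: le_esum => x _; rewrite -EFinD lee_fin /a /b.
  have u0 := normc_ge0 (f x); have v0 := normc_ge0 (g x).
  have h := normc_triangle (f x) (g x); have w0 := normc_ge0 ((f + g) x).
  apply: (@le_trans _ _ ((normc (f x) + normc (g x)) ^+ 2)).
    by rewrite ler_pXn2r// nnegrE ?addr_ge0.
  rewrite -subr_ge0; set u := normc (f x); set v := normc (g x).
  have -> : (1 + t) * u ^+ 2 + (1 + t^-1) * v ^+ 2 - (u + v) ^+ 2
          = t^-1 * (t * u - v) ^+ 2.
    by field; rewrite gt_eqF.
  by rewrite mulr_ge0 ?sqr_ge0// ltW.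
rewrite esumD; [|by move=> x _; rewrite lee_fin..].
by apply: leeD; apply: le_esumZ => [|x]; rewrite ?sqr_ge0// addr_ge0// ltW.
Qed.

Lemma sqsum0 : sqsum 0 = 0%E.
Proof. by apply: esum1 => x _; rewrite ComplexField.Normc.normc0 expr0n. Qed.

Lemma sqsummable_submod_closed : submod_closed sqsummable.
Proof.
split; first by apply/asboolP; rewrite sqsum0.
move=> c f g /asboolP fl /asboolP gl; apply/asboolP.
apply: le_lt_trans (sqsumD_le _ _ ltr01) _.
rewrite lte_add_pinfty// lte_mul_pinfty ?lee_fin ?invr1 ?addr_ge0//.
apply: le_lt_trans (sqsumZ_le _ _) _.
by rewrite lte_mul_pinfty ?lee_fin ?sqr_ge0.
Qed.

HB.instance Definition _ :=
  GRing.isSubmodClosed.Build _ _ sqsummable sqsummable_submod_closed.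

Record ell2 := Ell2 { ell2_fun :> X -> R[i]; _ : ell2_fun \in sqsummable }.

HB.instance Definition _ := [isSub for ell2_fun].
HB.instance Definition _ := [Choice of ell2 by <:].
HB.instance Definition _ := [SubChoice_isSubLmodule of ell2 by <:].

Definition l2norm (f : ell2) : R := Num.sqrt (fine (sqsum f)).

Lemma sqsum_fin (f : ell2) : sqsum f \is a fin_num.
Proof.
case: f => f /= /asboolP fl; rewrite fin_numElt fl andbT.
exact: lt_le_trans (ltNyr 0) (sqsum_ge0 f).
Qed.

Lemma l2norm_ge0 (f : ell2) : 0 <= l2norm f. Proof. exact: sqrtr_ge0. Qed.

Lemma l2normE (f : ell2) : (l2norm f ^+ 2)%:E = sqsum f.
Proof. by rewrite sqr_sqrtr ?fine_ge0 ?sqsum_ge0// fineK// sqsum_fin. Qed.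

Lemma l2norm_eq0 (f : ell2) : l2norm f = 0 -> f = 0.
Proof.
move=> f0; apply/val_inj/funext => x /=.
have := l2normE f; rewrite f0 expr0n => s0.
have : ((normc (f x) ^+ 2)%:E <= sqsum f)%E.
  apply: esum_ge; exists [set x]; first by split.
  by rewrite fsbig_set1.
rewrite -s0 lee_fin => le0; apply: ComplexField.Normc.eq0_normc.
by apply/eqP; rewrite -sqrf_eq0 eq_le le0 sqr_ge0.
Qed.

Lemma l2normD (f g : ell2) : l2norm (f + g) <= l2norm f + l2norm g.
Proof.
have F0 := l2norm_ge0 f; have G0 := l2norm_ge0 g.
have [f0|fn0] := eqVneq (l2norm f) 0.
  by rewrite f0 (l2norm_eq0 f0) !add0r.
have [g0|gn0] := eqVneq (l2norm g) 0.
  by rewrite g0 (l2norm_eq0 g0) !addr0.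
have Fp : 0 < l2norm f by rewrite lt_def fn0.
have Gp : 0 < l2norm g by rewrite lt_def gn0.
have tp : 0 < l2norm g / l2norm f by rewrite divr_gt0.
have := sqsumD_le (f : X -> R[i]) g tp.
rewrite -[(_ + _)%R]/((f + g : ell2) : X -> R[i]).
rewrite -!l2normE -!EFinM -EFinD lee_fin invf_div => h.
rewrite -(@ler_pXn2r _ 2)// ?nnegrE ?l2norm_ge0 ?addr_ge0//.
apply: le_trans h _; rewrite le_eqVlt; apply/orP; left; apply/eqP.
by field; rewrite fn0 gn0.
Qed.

Lemma l2normZ_le (c : R[i]) (f : ell2) : l2norm (c *: f) <= normc c * l2norm f.
Proof.
rewrite -(@ler_pXn2r _ 2)// ?nnegrE ?l2norm_ge0 ?mulr_ge0 ?normc_ge0 ?l2norm_ge0//.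
by rewrite -lee_fin exprMn [leRHS]EFinM !l2normE; exact: sqsumZ_le.
Qed.

Lemma l2normZ (c : R[i]) (f : ell2) : l2norm (c *: f) = normc c * l2norm f.
Proof.
have [->|c0] := eqVneq c 0.
  rewrite scale0r ComplexField.Normc.normc0 mul0r.
  apply/eqP; rewrite eq_le l2norm_ge0 andbT.
  by have := l2normZ_le 0 0; rewrite scale0r ComplexField.Normc.normc0 mul0r.
have nc0 : 0 < normc c.
  rewrite lt_def normc_ge0 andbT; apply: contra_neq c0.
  exact: ComplexField.Normc.eq0_normc.
apply/eqP; rewrite eq_le l2normZ_le /= mulrC -ler_pdivlMr// mulrC.
by rewrite -ComplexField.Normc.normcV -{1}(scalerK c0 f) l2normZ_le.
Qed.

Let cnorm (f : ell2) : R[i] := (l2norm f)%:C.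

Let cnormD (f g : ell2) : cnorm (f + g) <= cnorm f + cnorm g.
Proof. by rewrite -rmorphD lecR l2normD. Qed.

Let cnormZ (c : R[i]) (f : ell2) : cnorm (c *: f) = `|c| * cnorm f.
Proof. by rewrite /cnorm l2normZ rmorphM. Qed.

Let cnorm_eq0 (f : ell2) : cnorm f = 0 -> f = 0.
Proof. by move=> [/l2norm_eq0]. Qed.

HB.instance Definition _ :=
  Lmodule_isNormed.Build R[i] ell2 cnormD cnormZ cnorm_eq0.

(* Norms in a normedModType over R[i] are valued in R[i], so the real norm is
   embedded by %:C, here and for bop below. *)
Lemma ell2_normE (f : ell2) : `|f| = (l2norm f)%:C. Proof. by []. Qed.

End Ell2.

Arguments sqsummable {R X}.

Section Delta.
Variables (R : realType) (X : choiceType).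

Lemma sqsum_delta (x : X) : sqsum (fun y => (y == x)%:R : R[i]) = 1%E.
Proof.
rewrite /sqsum (esumID [set x])//; last by move=> y _; rewrite lee_fin sqr_ge0.
rewrite setTI esum_set1 ?lee_fin ?sqr_ge0// eqxx ComplexField.Normc.normc1.
rewrite expr1n esum1 ?adde0// => y [_ /= /eqP /negbTE ->].
by rewrite ComplexField.Normc.normc0 expr0n.
Qed.

Lemma delta_subproof (x : X) :
  (fun y => (y == x)%:R : R[i]) \in (sqsummable : {pred X -> R[i]}).
Proof. by apply/asboolP; rewrite sqsum_delta ltry. Qed.

Definition delta (x : X) : ell2 R X := Ell2 (delta_subproof x).

Lemma l2norm_delta x : l2norm (delta x) = 1.
Proof. by rewrite /l2norm sqsum_delta sqrtr1. Qed.

End Delta.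

Section Operators.
Variables (R : realType) (X : choiceType).
Local Notation H := (ell2 R X).

Definition bounded_op : {pred H -> H} :=
  fun T => `[< linear T /\ continuous T >].

Lemma bounded_op_submod_closed : submod_closed bounded_op.
Proof.
split.
  apply/asboolP; split; last exact: (@cst_continuous H H 0).
  by move=> c f g /=; rewrite scaler0 addr0.
move=> c S T /asboolP[Sl Sc] /asboolP[Tl Tc]; apply/asboolP; split.
  move=> d f g /=; rewrite -[LHS]/(c *: S _ + T _) -[RHS]/(d *: (c *: S f + T f) + (c *: S g + T g)).
  by rewrite Sl Tl !scalerDr !scalerA (mulrC c) addrACA.
move=> f; apply: (@cvgD _ _ _ (nbhs f) _ (fun f => c *: S f) T).
  by apply: cvgZr; exact: Sc.
exact: Tc.
Qed.

HB.instance Definition _ :=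
  GRing.isSubmodClosed.Build _ _ bounded_op bounded_op_submod_closed.

Record bop := Bop { bop_fun :> H -> H; _ : bop_fun \in bounded_op }.

HB.instance Definition _ := [isSub for bop_fun].
HB.instance Definition _ := [Choice of bop by <:].
HB.instance Definition _ := [SubChoice_isSubLmodule of bop by <:].

Lemma bop_linear (T : bop) : linear T.
Proof. by case: T => T /= /asboolP[]. Qed.

HB.instance Definition _ (T : bop) :=
  GRing.isLinear.Build R[i] H H _ T (bop_linear T).

Lemma bop_continuous (T : bop) : continuous T.
Proof. by case: T => T /= /asboolP[]. Qed.

Lemma bop_bounded (T : bop) :
  exists2 M : R, 0 <= M & forall f, l2norm (T f) <= M * l2norm f.
Proof.
have /linear_boundedP := continuous_linear_bounded 0 (f := T) (@bop_continuous T 0).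
move=> [M0 [/complex_realP [M ->] hM]].
exists (`|M| + 1); first by rewrite addr_ge0.
move=> f; have := hM (`|M| + 1)%:C.
rewrite ltcR ltr_pwDr ?ler_norm// => /(_ isT f).
by rewrite !ell2_normE -rmorphM lecR.
Qed.

Lemma bounded_opP (T : H -> H) (M : R) : linear T ->
  (forall f, l2norm (T f) <= M * l2norm f) -> T \in bounded_op.
Proof.
move=> Tl TM; apply/asboolP; split => //.
pose T' := GRing.isLinear.Build R[i] H H _ T Tl.
pose TL : {linear H -> H} := HB.pack T T'.
apply: (bounded_linear_continuous (f := TL)); apply/linear_boundedP.
exists M%:C; split; first by apply/complex_realP; exists M.
move=> r Mr f; rewrite !ell2_normE.
apply: (@le_trans _ _ (M%:C * (l2norm f)%:C)).
  by rewrite -rmorphM lecR.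
by rewrite ler_wpM2r ?ler0c ?l2norm_ge0// ltW.
Qed.

Definition opnorm (T : bop) : R :=
  sup [set l2norm (T f) | f in [set f | l2norm f <= 1]].

Lemma l2norm0 : l2norm (0 : H) = 0.
Proof. by rewrite /l2norm sqsum0 sqrtr0. Qed.

Lemma opnorm_has_sup (T : bop) :
  has_sup [set l2norm (T f) | f in [set f | l2norm f <= 1]].
Proof.
split; first by exists (l2norm (T 0)); exists 0 => //=; rewrite l2norm0.
have [M M0 TM] := bop_bounded T; exists M => _ [f /= f1 <-].
by apply: le_trans (TM f) _; rewrite ler_piMr.
Qed.

Lemma opnorm_ge0 T : 0 <= opnorm T.
Proof.
apply: (@le_trans _ _ (l2norm (T 0))); first exact: l2norm_ge0.
by apply: ub_le_sup; [exact: (opnorm_has_sup T).2|exists 0 => //=; rewrite l2norm0].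
Qed.

Lemma le_opnorm (T : bop) f : l2norm (T f) <= opnorm T * l2norm f.
Proof.
have [f0|fn0] := eqVneq (l2norm f) 0.
  by rewrite (l2norm_eq0 f0) linear0 l2norm0 mulr0.
have fp : 0 < l2norm f by rewrite lt_def fn0 l2norm_ge0.
rewrite -ler_pdivrMr//.
have nci : normc ((l2norm f)^-1)%:C = (l2norm f)^-1.
  by rewrite /= expr0n/= addr0 sqrtr_sqr ger0_norm// invr_ge0 ltW.
apply: ub_le_sup; first exact: (opnorm_has_sup T).2.
exists (((l2norm f)^-1)%:C *: f) => /=.
  by rewrite l2normZ nci mulVf.
by rewrite linearZ l2normZ nci mulrC.
Qed.

Lemma opnorm_le (T : bop) (M : R) : 0 <= M ->
  (forall f, l2norm (T f) <= M * l2norm f) -> opnorm T <= M.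
Proof.
move=> M0 TM; apply: ge_sup; first exact: (opnorm_has_sup T).1.
by move=> _ [f /= f1 <-]; apply: le_trans (TM f) _; rewrite ler_piMr.
Qed.

Lemma bop_addE (S T : bop) f : (S + T) f = S f + T f. Proof. by []. Qed.
Lemma bop_scaleE c (T : bop) f : (c *: T) f = c *: T f. Proof. by []. Qed.

Lemma opnorm_eq0 T : opnorm T = 0 -> T = 0.
Proof.
move=> T0; apply/val_inj/funext => f /=; apply: l2norm_eq0.
by apply/eqP; rewrite eq_le l2norm_ge0 andbT -(mul0r (l2norm f)) -T0 le_opnorm.
Qed.

Lemma opnormD S T : opnorm (S + T) <= opnorm S + opnorm T.
Proof.
apply: opnorm_le => [|f]; first by rewrite addr_ge0 ?opnorm_ge0.
rewrite bop_addE mulrDl; apply: le_trans (l2normD _ _) _.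
by rewrite lerD ?le_opnorm.
Qed.

Lemma opnormZ_le (c : R[i]) T : opnorm (c *: T) <= normc c * opnorm T.
Proof.
apply: opnorm_le => [|f]; first by rewrite mulr_ge0 ?normc_ge0 ?opnorm_ge0.
by rewrite bop_scaleE l2normZ -mulrA ler_wpM2l ?normc_ge0 ?le_opnorm.
Qed.

Lemma opnormZ (c : R[i]) T : opnorm (c *: T) = normc c * opnorm T.
Proof.
have [->|c0] := eqVneq c 0.
  rewrite scale0r ComplexField.Normc.normc0 mul0r.
  apply/eqP; rewrite eq_le opnorm_ge0 andbT.
  by have := opnormZ_le 0 0; rewrite scale0r ComplexField.Normc.normc0 mul0r.
have nc0 : 0 < normc c.
  rewrite lt_def normc_ge0 andbT; apply: contra_neq c0.
  exact: ComplexField.Normc.eq0_normc.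
apply/eqP; rewrite eq_le opnormZ_le /= mulrC -ler_pdivlMr// mulrC.
by rewrite -ComplexField.Normc.normcV -{1}(scalerK c0 T) opnormZ_le.
Qed.

Let cnorm T : R[i] := (opnorm T)%:C.

Let cnormD S T : cnorm (S + T) <= cnorm S + cnorm T.
Proof. by rewrite -rmorphD lecR opnormD. Qed.

Let cnormZ (c : R[i]) T : cnorm (c *: T) = `|c| * cnorm T.
Proof. by rewrite /cnorm opnormZ rmorphM. Qed.

Let cnorm_eq0 T : cnorm T = 0 -> T = 0.
Proof. by move=> [/opnorm_eq0]. Qed.

HB.instance Definition _ :=
  Lmodule_isNormed.Build R[i] bop cnormD cnormZ cnorm_eq0.

Lemma bop_normE (T : bop) : `|T| = (opnorm T)%:C. Proof. by []. Qed.

Lemma bcomp_subproof (S T : bop) : S \o T \in bounded_op.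
Proof.
apply/asboolP; split; first by move=> c f g; rewrite /= !linearP.
by move=> f; apply: continuous_comp; exact: bop_continuous.
Qed.

Definition bcomp (S T : bop) : bop := Bop (bcomp_subproof S T).

Lemma bid_subproof : (id : H -> H) \in bounded_op.
Proof. by apply/asboolP; split => // f; exact: cvg_id. Qed.

Definition bid : bop := Bop bid_subproof.

(* Elements of the k-fold Hilbert direct sum of H are k-tuples of elements of
   H; a k x k matrix of operators acts on them by the matrix product. *)
Definition colnorm k (x : 'I_k -> H) : R :=
  Num.sqrt (\sum_i l2norm (x i) ^+ 2).

Definition mxact k (a : 'M[bop]_k) (x : 'I_k -> H) : 'I_k -> H :=
  fun i => \sum_j a i j (x j).

Definition mxopnorm k (a : 'M[bop]_k) : R :=
  sup [set colnorm (mxact a x) | x in [set x | colnorm x <= 1]].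

Lemma mxopnorm_has_sup k (a : 'M[bop]_k) :
  has_sup [set colnorm (mxact a x) | x in [set x | colnorm x <= 1]].
Proof.
split.
  exists (colnorm (mxact a (fun=> 0))); exists (fun=> 0) => //=.
  by rewrite /colnorm big1 ?sqrtr0// => i _; rewrite l2norm0 expr0n.
exists (Num.sqrt (\sum_i (\sum_j opnorm (a i j)) ^+ 2)) => _ [x /= x1 <-].
rewrite ler_wsqrtr//; apply: ler_sum => i _.
rewrite ler_pXn2r ?nnegrE ?l2norm_ge0 ?sumr_ge0// => [|j _]; last exact: opnorm_ge0.
have xj j : l2norm (x j) <= 1.
  apply: le_trans x1; rewrite -(ger0_norm (l2norm_ge0 (x j))) -sqrtr_sqr.
  rewrite ler_wsqrtr// (bigD1 j)//= lerDl sumr_ge0// => ? _; exact: sqr_ge0.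
have sumle (I : seq 'I_k) (F : 'I_k -> H) :
    l2norm (\sum_(j <- I) F j) <= \sum_(j <- I) l2norm (F j).
  elim/big_rec2: _ => [|j y1 y2 _ h]; first by rewrite l2norm0.
  by apply: le_trans (l2normD _ _) _; rewrite lerD2l.
apply: le_trans (sumle _ _) _; apply: ler_sum => j _.
by apply: le_trans (le_opnorm _ _) _; rewrite ler_piMr ?opnorm_ge0.
Qed.

Definition closed_subalg (S : set bop) : Prop :=
  [/\ closed S, S 0,
      forall (c : R[i]) a b, S a -> S b -> S (c *: a + b)
    & forall a b, S a -> S b -> S (bcomp a b)].

Record closedSubalg := ClosedSubalg {
  cs_set : set bop;
  cs_closed : closed_subalg cs_set }.

Definition closed_alg_gen_set (G : set bop) : set bop := smallest closed_subalg G.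

Lemma closed_alg_gen_subproof G : closed_subalg (closed_alg_gen_set G).
Proof.
split.
- by apply: closed_bigI => S [[]].
- by move=> S [[_ S0 _ _]].
- by move=> c a b Ga Gb S SG; have [[_ _ h _] _] := SG; apply: h; [exact: Ga|exact: Gb].
- by move=> a b Ga Gb S SG; have [[_ _ _ h] _] := SG; apply: h; [exact: Ga|exact: Gb].
Qed.

Definition closed_alg_gen (G : set bop) : closedSubalg :=
  ClosedSubalg (closed_alg_gen_subproof G).

End Operators.

(* A (concrete) operator algebra: a normed algebra with an isometric
   representation on a Hilbert space whose range is norm closed. Every Hilbert
   space is unitarily equivalent to some ell2 R X, hence the choice of space.
   No unit is required. *)
Record opAlg (R : realType) := OpAlg {
  oa_car :> normedModType R[i];
  oa_mul : oa_car -> oa_car -> oa_car;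
  oa_ix : choiceType;
  oa_rep : {linear oa_car -> bop R oa_ix};
  oa_repM : forall a b, oa_rep (oa_mul a b) = bcomp (oa_rep a) (oa_rep b);
  oa_rep_norm : forall a, `|oa_rep a| = `|a|;
  oa_closed : closed (range oa_rep) }.

Definition mxnorm (R : realType) (A : opAlg R) k (a : 'M[A]_k) : R :=
  mxopnorm (map_mx (@oa_rep R A) a).

Section Subalgebra.
Variables (R : realType) (X : choiceType) (S : closedSubalg R X).

Definition in_subalg : {pred bop R X} := fun a => `[< cs_set S a >].

Lemma in_subalg_submod_closed : submod_closed in_subalg.
Proof.
have [_ S0 SD _] := cs_closed S; split; first exact/asboolP.
by move=> c a b /asboolP Sa /asboolP Sb; apply/asboolP; exact: SD.
Qed.

HB.instance Definition _ :=
  GRing.isSubmodClosed.Build _ _ in_subalg in_subalg_submod_closed.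

Record subalg := SubAlg { sa_val :> bop R X; _ : sa_val \in in_subalg }.

HB.instance Definition _ := [isSub for sa_val].
HB.instance Definition _ := [Choice of subalg by <:].
HB.instance Definition _ := [SubChoice_isSubLmodule of subalg by <:].

Let nrm (a : subalg) : R[i] := `|sa_val a|.

Let nrmD (a b : subalg) : nrm (a + b) <= nrm a + nrm b.
Proof. exact: ler_normD. Qed.

Let nrmZ (c : R[i]) (a : subalg) : nrm (c *: a) = `|c| * nrm a.
Proof. exact: normrZ. Qed.

Let nrm_eq0 (a : subalg) : nrm a = 0 -> a = 0.
Proof. by move=> /normr0_eq0 a0; apply: val_inj. Qed.

HB.instance Definition _ :=
  Lmodule_isNormed.Build R[i] subalg nrmD nrmZ nrm_eq0.

Lemma sa_val_linear : linear sa_val.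
Proof. by []. Qed.

HB.instance Definition _ :=
  GRing.isLinear.Build R[i] subalg (bop R X) _ sa_val sa_val_linear.

Lemma sa_mul_subproof (a b : subalg) : bcomp a b \in in_subalg.
Proof.
have [_ _ _ SM] := cs_closed S.
case: a b => [a /= /asboolP Sa] [b /= /asboolP Sb].
by apply/asboolP; exact: SM.
Qed.

Definition sa_mul (a b : subalg) : subalg := SubAlg (sa_mul_subproof a b).

Lemma sa_closed : closed (range sa_val).
Proof.
have -> : range sa_val = cs_set S.
  apply/seteqP; split => [_ [[a /= /asboolP Sa] _ <-]//|a Sa].
  have Sa' : a \in in_subalg by exact/asboolP.
  by exists (SubAlg Sa').
by have [] := cs_closed S.
Qed.

Definition subalg_opAlg : opAlg R :=
  @OpAlg R subalg sa_mul X sa_val (fun _ _ => erefl) (fun _ => erefl) sa_closed.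

End Subalgebra.

Section Scalars.
Variable R : realType.

Definition sc_rep (z : R[i]^o) : bop R unit := z *: bid R unit.

Lemma sc_rep_linear : linear sc_rep.
Proof. by move=> c a b; rewrite /sc_rep scalerDl scalerA. Qed.

HB.instance Definition _ :=
  GRing.isLinear.Build R[i] R[i]^o (bop R unit) _ sc_rep sc_rep_linear.

Lemma sc_repM (a b : R[i]^o) : sc_rep (a * b) = bcomp (sc_rep a) (sc_rep b).
Proof.
apply/val_inj/funext => f.
by rewrite -[LHS]/((a * b : R[i]) *: f) -[RHS]/(a *: (b *: f)) scalerA.
Qed.

Lemma sc_rep_norm (a : R[i]^o) : `|sc_rep a| = `|a|.
Proof.
rewrite normrZ bop_normE -[RHS]mulr1; congr (_ * _%:C).
apply/eqP; rewrite eq_le; apply/andP; split.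
  by apply: opnorm_le => // f; rewrite mul1r.
have := le_opnorm (bid R unit) (delta R tt).
by rewrite /= l2norm_delta mulr1.
Qed.

Lemma sc_closed : closed (range sc_rep).
Proof.
suff -> : range sc_rep = setT by exact: closedT.
apply/seteqP; split=> // T _; exists (T (delta R tt) tt) => //.
have dE (f : ell2 R unit) : f = f tt *: delta R tt.
  by apply/val_inj/funext => -[] /=; rewrite -[RHS]/(f tt * 1) mulr1.
apply/val_inj/funext => f; rewrite -[LHS]/(T (delta R tt) tt *: f).
by rewrite -[RHS]/(T f) [in RHS](dE f) linearZ/= [in RHS](dE (T _)) {1}(dE f) !scalerA mulrC.
Qed.

Definition scalars : opAlg R :=
  @OpAlg R R[i]^o *%R unit sc_rep sc_repM sc_rep_norm sc_closed.

End Scalars.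

Section Homomorphisms.
Variable R : realType.
Implicit Types A B C : opAlg R.

(* Completely contractive homomorphisms; they need not be unital. *)
Definition cc_hom A B (phi : A -> B) : Prop :=
  [/\ linear phi,
      forall a b, phi (oa_mul a b) = oa_mul (phi a) (phi b)
    & forall k (a : 'M[A]_k), mxnorm (map_mx phi a) <= mxnorm a].

Definition mult_functional A (phi : A -> scalars R) : Prop :=
  [/\ linear phi,
      forall a b, phi (oa_mul a b) = oa_mul (phi a) (phi b)
    & exists a, phi a != 0].

(* Complete contractivity of phi is not part of this definition; it is required
   separately in factors_through, and is automatic for a multiplicative
   functional. *)
Definition derivation_at A B (phi D : A -> B) : Prop :=
  [/\ linear D, continuous D
    & forall a b, D (oa_mul a b) = oa_mul (D a) (phi b) + oa_mul (phi a) (D b)].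

Definition factors_through A B (C : opAlg R) (phi D : A -> B) : Prop :=
  exists (iota : A -> C) (phi' D' : C -> B),
    [/\ cc_hom iota, cc_hom phi', phi = phi' \o iota,
        derivation_at phi' D' & D = D' \o iota].

End Homomorphisms.

Record digraph := Digraph {
  vert : choiceType;
  edge : choiceType;
  grange : edge -> vert;
  gsource : edge -> vert }.

Definition countable_graph (Q : digraph) : Prop :=
  countable [set: vert Q] /\ countable [set: edge Q].

Section Paths.
Variable Q : digraph.

(* A path is stored with its source vertex: (e1 ... en, s(en)), a vertex v
   being ([::], v). *)
Definition range_of (p : seq (edge Q) * vert Q) : vert Q :=
  if p.1 is e :: _ then grange e else p.2.

Fixpoint composable (es : seq (edge Q)) (v : vert Q) : bool :=
  if es is e :: es' then
    (gsource e == range_of (es', v)) && composable es' v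
  else true.

Definition gpath := {p : seq (edge Q) * vert Q | composable p.1 p.2}.

Definition path_range (u : gpath) : vert Q := range_of (val u).

(* eu when r(u) = s(e), None otherwise *)
Definition path_cons (e : edge Q) (u : gpath) : option gpath :=
  insub (e :: (val u).1, (val u).2).

(* the u such that w = eu, if any *)
Definition path_strip (e : edge Q) (w : gpath) : option gpath :=
  if (val w).1 is e' :: es then
    if e' == e then (insub (es, (val w).2) : option gpath) else None
  else None.

Lemma path_consE e u : isSome (path_cons e u) = (gsource e == path_range u).
Proof.
rewrite /path_cons /path_range; case: u => -[es v] /= uP.
by case: insubP => [w /= /andP[]//|] /=; rewrite uP andbT => /negbTE.
Qed.

Lemma path_stripP e u w : path_strip e w = Some u <-> path_cons e u = Some w.
Proof.
have insubE (p : seq (edge Q) * vert Q) (x : gpath) :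
    insub p = Some x -> p = val x.
  by case: insubP => // y _ <- [->].
rewrite /path_strip /path_cons; split.
  case wE : (val w).1 => [//|e' es]; case: eqP => // e'e /insubE uE.
  by rewrite -uE /= -e'e -wE -surjective_pairing valK.
by move=> /insubE <- /=; rewrite eqxx -surjective_pairing valK.
Qed.

End Paths.

Section PartialShift.
Variables (R : realType) (X : choiceType) (s : X -> option X).
Hypothesis s_inj : forall x y z, s x = Some z -> s y = Some z -> x = y.

Definition pullback (f : X -> R[i]) : X -> R[i] :=
  fun x => if s x is Some y then f y else 0.

Lemma sqsum_pullback f : (sqsum (pullback f) <= sqsum f)%E.
Proof.
pose D := [set x | isSome (s x)]; pose e x := odflt x (s x).
have eD x y : D x -> s x = Some y -> e x = y by rewrite /e => _ ->.
rewrite /sqsum (esumID D)//; last by move=> x _; rewrite lee_fin sqr_ge0.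
rewrite [X in (_ + X)%E]esum1 ?adde0; last first.
  move=> x [_]; rewrite /D /= /pullback; case: (s x) => // _.
  by rewrite ComplexField.Normc.normc0 expr0n.
rewrite setTI (eq_esum (b := fun x => (normc (f (e x)) ^+ 2)%:E)); last first.
  by move=> x; rewrite /D/= /pullback /e; case: (s x).
rewrite -(@reindex_esum R X X D (e @` D) e
  (fun y => (normc (f y) ^+ 2)%:E)); last first.
  apply: inj_bij.
  move=> x y; rewrite !inE /D /e /=; case sx : (s x) => [x'|//] _.
  by case sy : (s y) => [y'|//] _ /= E; subst; exact: s_inj sx sy.
rewrite esum_mkcond; apply: le_esum => x _.
by case: ifP => _ //; rewrite lee_fin sqr_ge0.
Qed.

Lemma pullback_subproof (f : ell2 R X) : pullback f \in sqsummable.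
Proof.
apply/asboolP; apply: le_lt_trans (sqsum_pullback f) _.
by case: f => f /= /asboolP.
Qed.

Definition pullback_fun (f : ell2 R X) : ell2 R X := Ell2 (pullback_subproof f).

Lemma pullback_bounded : pullback_fun \in @bounded_op R X.
Proof.
apply: (@bounded_opP _ _ _ 1).
  move=> c f g; apply/val_inj/funext => x /=.
  rewrite -[RHS]/(c * pullback f x + pullback g x) /pullback.
  by case: (s x) => [y//|]; rewrite mulr0 addr0.
move=> f; rewrite mul1r -(@ler_pXn2r _ 2)// ?nnegrE ?l2norm_ge0//.
by rewrite -lee_fin !l2normE sqsum_pullback.
Qed.

End PartialShift.

Section Toeplitz.
Variables (R : realType) (Q : digraph).
Local Notation H := (ell2 R (gpath Q)).

Lemma L_inj (e : edge Q) x y z :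
  path_strip e x = Some z -> path_strip e y = Some z -> x = y.
Proof. by move=> /path_stripP zx /path_stripP; rewrite zx => -[]. Qed.

(* (L_e f)(w) = f(u) if w = eu, and 0 if w does not start with e *)
Definition Lop (e : edge Q) : bop R (gpath Q) :=
  Bop (pullback_bounded R (@L_inj e)).

Definition P_dom (v : vert Q) (w : gpath Q) : option (gpath Q) :=
  if path_range w == v then Some w else None.

Lemma P_inj v x y z : P_dom v x = Some z -> P_dom v y = Some z -> x = y.
Proof. by rewrite /P_dom; do 2!case: eqP => // _; move=> [->] []. Qed.

(* (P_v f)(w) = f(w) if r(w) = v, and 0 otherwise *)
Definition Pop (v : vert Q) : bop R (gpath Q) :=
  Bop (pullback_bounded R (@P_inj v)).

Lemma Lop_delta e u :
  Lop e (delta R u) = if path_cons e u is Some w then delta R w else 0.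
Proof.
apply/val_inj/funext => w /=; rewrite /pullback.
case su : (path_strip e w) => [u'|]; case cu : (path_cons e u) => [w'|] //=.
- have /path_stripP cu' := su; congr (nat_of_bool _)%:R; apply/eqP/eqP => [E|E].
    by move: cu'; rewrite E cu => -[].
  by subst w'; move: cu => /path_stripP; rewrite su => -[].
- case: eqP => // E; subst u'.
  by move: su => /path_stripP; rewrite cu.
- case: eqP => // E; subst w'.
  by move: cu => /path_stripP; rewrite su.
Qed.

Lemma Pop_delta v u :
  Pop v (delta R u) = if path_range u == v then delta R u else 0.
Proof.
apply/val_inj/funext => w /=; rewrite /pullback /P_dom.
case: (eqVneq w u) => [->|wu]; first by case: ifP => //=; rewrite eqxx.
by case: ifP; case: ifP => //= _ _; rewrite (negbTE wu).
Qed.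

Definition toeplitz_gens : set (bop R (gpath Q)) := range Pop `|` range Lop.

(* T^+(Q), acting on the Hilbert space with orthonormal basis the paths *)
Definition toeplitz_alg : opAlg R :=
  subalg_opAlg (closed_alg_gen toeplitz_gens).

End Toeplitz.

(* n = None stands for infinity *)
Definition bouquet_edge (n : option nat) : choiceType :=
  if n is Some m then 'I_m else nat.

Definition bouquet (n : option nat) : digraph :=
  @Digraph unit (bouquet_edge n) (fun=> tt) (fun=> tt).

(* A_n = T^+(B_n) *)
Definition bouquet_alg (R : realType) (n : option nat) : opAlg R :=
  toeplitz_alg R (bouquet n).

(* Main.v *)
From HB Require Import structures.
Require Import Defs.
From mathcomp Require Import all_boot all_order all_algebra.
From mathcomp Require Import all_classical all_reals all_analysis.
From mathcomp Require Import complex finmap.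
From mathcomp Require Import ring lra.

(** The value [n = None] always works: every continuous derivation at a
multiplicative functional [phi] factors through the algebra of the bouquet
with countably many edges.

The values of [phi] and [D] on generators come from few edges.  Since [phi] is
a nonzero homomorphism, it takes the value 1 on exactly one vertex projection
[P_v] and 0 on the others, and [D] vanishes on every idempotent.  Writing
[L_d = P_(r(d)) L_d P_(s(d))] one sees that [phi] and [D] vanish on [L_d]
unless [d] is a loop at [v].

It remains to move the loops at [v] in and out of a bouquet.  Let [I] index a
family of loops at a vertex [v1] of [Q1] and a family of loops at a vertex [v2]
of [Q2].  The paths in [Q1] made of loops of the first family span a subspace
whose orthogonal complement is invariant under the algebra of [Q1], so the
compression to it is multiplicative, and it is modelled on the words over [I].
On the other side, every path of [Q2] with range [v2] is in a unique way a word
in the loops of the second family followed by a path that does not start with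
such a loop; hence [P_v2 H] is a multiple of the word space, and an operator on
words acts on it by amplification.  Compressing and then amplifying
([toeplitz_transfer]) is a completely contractive homomorphism that carries the
first loops to the second ones, [P_v1] to [P_v2] and all other generators to 0.

With [I] the loops at [v], injected in the countably many loops of the bouquet,
this one construction gives [iota] from the algebra of [Q] to that of the
bouquet and, with the roles exchanged, [sigma] in the other direction.  Take
[phi o sigma] and [D o sigma] on the bouquet algebra.  The composite
[sigma o iota] fixes [P_v] and the loops at [v] and kills the other generators,
on which [phi] and [D] vanish anyway; so [phi o sigma o iota = phi] and
[D o sigma o iota = D] hold on generators, hence everywhere by continuity.

Two facts about functionals complete the argument.  A multiplicative functional
on a norm closed algebra of operators is contractive: if [phi a = 1] with
[|a| < 1], the Neumann series gives [b] with [b = a + a b], and applying [phi]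
yields [0 = 1].  It is then completely contractive, because the pairing of the
scalar matrix [phi(a_ij)] with two vectors is the value of [phi] at a linear
combination of the [a_ij] whose norm is controlled by that of the matrix. *)

Set Implicit Arguments.
Unset Strict Implicit.
Unset Printing Implicit Defensive.
Import Order.TTheory GRing.Theory Num.Theory.
Import numFieldNormedType.Exports.
Local Open Scope classical_set_scope.
Local Open Scope ring_scope.
Local Open Scope complex_scope.

(** * Completeness of the algebra of bounded operators *)

Section Ell2Facts.
Variables (R : realType) (X : choiceType).
Implicit Types f g : ell2 R X.

Lemma normcN (z : R[i]) : normc (- z) = normc z.
Proof. by case: z => a b /=; rewrite !sqrrN. Qed.

Lemma normc_dist (a b : R[i]) : `|normc a - normc b| <= normc (a - b).
Proof.
have h1 := normc_triangle (a - b) b; have h2 := normc_triangle (b - a) a.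
rewrite subrK in h1; rewrite subrK -[normc (b - a)]normcN opprB in h2.
by rewrite ler_norml; apply/andP; split; lra.
Qed.

Lemma sqsum_le (h : X -> R[i]) (C : R) :
  (forall F : {fset X}, \sum_(x <- F) normc (h x) ^+ 2 <= C) ->
  (sqsum h <= C%:E)%E.
Proof.
move=> hC; apply: ge_ereal_sup => _ [A [Afin _] <-].
rewrite fsbig_finite//= sumEFin lee_fin; exact: hC.
Qed.

Lemma fsum_le_l2norm f (F : {fset X}) :
  \sum_(x <- F) normc (f x) ^+ 2 <= l2norm f ^+ 2.
Proof.
rewrite -lee_fin l2normE -sumEFin; apply: esum_ge; exists [set` F].
  by split => //; exact: finite_fset.
by rewrite fsbig_finite//= set_fsetK.
Qed.

Lemma l2norm_le f (C : R) : 0 <= C ->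
  (sqsum f <= (C ^+ 2)%:E)%E -> l2norm f <= C.
Proof.
by move=> C0; rewrite -l2normE lee_fin ler_pXn2r// nnegrE l2norm_ge0.
Qed.

Lemma normc_le_l2norm f x : normc (f x) <= l2norm f.
Proof.
rewrite -(@ler_pXn2r _ 2)// ?nnegrE ?normc_ge0 ?l2norm_ge0//.
by have := fsum_le_l2norm f [fset x]%fset; rewrite big_seq_fset1.
Qed.

End Ell2Facts.

Section Completeness.
Variable R : realType.
Variable e_ : nat -> R.
Hypothesis e_cvg : e_ @ \oo --> (0 : R).

Lemma real_cauchy_cvg (v : nat -> R) (c : R) :
  (forall n m, `|v (n + m)%N - v n| <= e_ n * c) -> cvgn v.
Proof.
move=> hv; apply: cauchy_cvg; apply: cauchy_exP => eps eps0.
have ec : (fun n => e_ n * c) @ \oo --> (0 : R).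
  by rewrite -[0](mul0r c); apply: cvgM => //; exact: cvg_cst.
have [N _ hN] : \forall n \near \oo, `|0 - e_ n * c| < eps.
  by move: ec => /cvgrPdist_lt; apply.
exists (v N); exists N => //= n /= Nn.
rewrite /ball/= -(subnKC Nn) distrC.
apply: le_lt_trans (hv _ _) _.
by have := hN N (leqnn N); rewrite sub0r normrN; apply: le_lt_trans; exact: ler_norm.
Qed.

(** The limit is found on real and imaginary parts; convergence is stated for the
    real-valued distances, which is how it is used. *)
Lemma complex_cauchy_cvg (u : nat -> R[i]) (c : R) :
  (forall n m, normc (u (n + m)%N - u n) <= e_ n * c) ->
  exists l, (fun n => normc (u n - l)) @ \oo --> (0 : R).
Proof.
move=> hu.
have re_le (z : R[i]) : `|complex.Re z| <= normc z.
  by case: z => a b /=; rewrite -sqrtr_sqr ler_wsqrtr// lerDl sqr_ge0.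
have im_le (z : R[i]) : `|complex.Im z| <= normc z.
  by case: z => a b /=; rewrite -sqrtr_sqr ler_wsqrtr// lerDr sqr_ge0.
have n_le (z : R[i]) : normc z <= `|complex.Re z| + `|complex.Im z|.
  case: z => a b /=; rewrite -[leRHS]ger0_norm ?addr_ge0// -sqrtr_sqr ler_wsqrtr//.
  rewrite -[X in X + _]real_normK ?num_real// -[X in _ + X]real_normK ?num_real//.
  by rewrite sqrrD -addrA lerD2l lerDr mulrn_wge0// mulr_ge0.
have cr : cvgn (fun n => complex.Re (u n)).
  apply: (@real_cauchy_cvg _ c) => n m; apply: le_trans (hu n m).
  by apply: le_trans (re_le _); rewrite /= raddfB.
have ci : cvgn (fun n => complex.Im (u n)).
  apply: (@real_cauchy_cvg _ c) => n m; apply: le_trans (hu n m).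
  by apply: le_trans (im_le _); rewrite /= raddfB.
exists (Complex (limn (fun n => complex.Re (u n))) (limn (fun n => complex.Im (u n)))).
have h0 : (fun n => `|complex.Re (u n) - limn (fun n => complex.Re (u n))| +
                    `|complex.Im (u n) - limn (fun n => complex.Im (u n))|) @ \oo --> (0 : R).
  rewrite -[0]addr0; apply: cvgD; apply/norm_cvg0P/subr_cvg0; assumption.
apply: (squeeze_cvgr _ (cvg_cst 0) h0); near=> n.
rewrite normc_ge0/=; apply: le_trans (n_le _) _; rewrite !raddfB//.
Unshelve. all: by end_near. Qed.

End Completeness.

Section BopComplete.
Variables (R : realType) (X : choiceType).
Local Notation H := (ell2 R X).

(** The rate [e_] survives in the limit, which spares the user any
    further estimate.  The limit operator is built coordinatewise; the bound on
    its distance to [T_ n] is obtained on finite sets of coordinates, where it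
    passes to the limit. *)
Lemma bop_complete (e_ : nat -> R) (T_ : nat -> bop R X) :
  e_ @ \oo --> (0 : R) ->
  (forall n m, opnorm (T_ (n + m)%N - T_ n) <= e_ n) ->
  exists T, forall n, opnorm (T - T_ n) <= e_ n.
Proof.
move=> e0 Te.
have en n : 0 <= e_ n by apply: le_trans (Te n 0%N); exact: opnorm_ge0.
have Tef n m f : l2norm (T_ (n + m)%N f - T_ n f) <= e_ n * l2norm f.
  apply: le_trans (le_opnorm (T_ (n + m)%N - T_ n) f) _.
  by rewrite ler_wpM2r ?l2norm_ge0.
have L (f : H) (x : X) :
    exists l, (fun n => normc (T_ n f x - l)) @ \oo --> (0 : R).
  apply: (complex_cauchy_cvg e0 (c := l2norm f)) => n m.
  apply: le_trans (Tef n m f).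
  exact: (normc_le_l2norm (T_ (n + m)%N f - T_ n f)).
pose l f x := sval (cid (L f x)).
have lP f x : (fun n => normc (T_ n f x - l f x)) @ \oo --> (0 : R).
  exact: svalP (cid (L f x)).
have l_uniq f x z : (fun n => normc (T_ n f x - z)) @ \oo --> (0 : R) -> z = l f x.
  move=> zP; apply/eqP; rewrite -subr_eq0; apply/eqP.
  apply: ComplexField.Normc.eq0_normc; apply/eqP.
  rewrite eq_le normc_ge0 andbT.
  have h := cvgD (lP f x) zP; rewrite addr0 in h.
  apply: (cvgr_to_ge (h _)); near=> n => /=.
  have -> : z - l f x = (T_ n f x - l f x) - (T_ n f x - z) by ring.
  by apply: le_trans (normc_triangle _ _) _; rewrite normcN.
have dl f n : (sqsum (fun x => l f x - T_ n f x)%R <= ((e_ n * l2norm f) ^+ 2)%:E)%E.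
  apply: sqsum_le => F.
  have hx x : (fun m => normc (T_ (n + m)%N f x - T_ n f x) ^+ 2) @ \oo -->
      normc (l f x - T_ n f x) ^+ 2.
    rewrite expr2; under eq_fun do rewrite expr2.
    suff h : (fun m => normc (T_ (n + m)%N f x - T_ n f x)) @ \oo -->
        normc (l f x - T_ n f x) by apply: cvgM.
    suff h : (fun m => normc (T_ m f x - T_ n f x)) @ \oo -->
        normc (l f x - T_ n f x).
      rewrite -(cvg_shiftn n) /= in h.
      by under eq_fun do rewrite addnC.
    apply/subr_cvg0/norm_cvg0P.
    apply: (squeeze_cvgr _ (cvg_cst 0) (lP f x)); near=> m.
    rewrite normr_ge0/=; apply: le_trans (normc_dist _ _) _.
    by rewrite opprB addrA subrK.
  have hs : (fun m => \sum_(x <- F) normc (T_ (n + m)%N f x - T_ n f x) ^+ 2) @ \oo -->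
      \sum_(x <- F) normc (l f x - T_ n f x) ^+ 2.
    by apply: cvg_big => //; exact: add_continuous.
  apply: (cvgr_to_le hs); near=> m => /=.
  apply: le_trans (fsum_le_l2norm (T_ (n + m)%N f - T_ n f) F) _.
  by rewrite ler_pXn2r ?nnegrE ?l2norm_ge0 ?mulr_ge0 ?l2norm_ge0.
pose Df f n : X -> R[i] := fun x => l f x - T_ n f x.
have DfS f n : Df f n \in sqsummable by apply/asboolP; exact: le_lt_trans (dl f n) (ltry _).
(* The limit l f is square summable because it differs from T_ 0 f by a
   vector whose norm is at most e_ 0 times that of f. *)
pose Tf f : H := Ell2 (DfS f 0%N) + T_ 0%N f.
have TfE f x : Tf f x = l f x by rewrite -[LHS]/(l f x - T_ 0%N f x + T_ 0%N f x) subrK.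
have Tl n f : l2norm (Tf f - T_ n f) <= e_ n * l2norm f.
  apply: l2norm_le; first by rewrite mulr_ge0 ?l2norm_ge0.
  suff -> : ((Tf f - T_ n f : H) : X -> R[i]) = (fun x => l f x - T_ n f x) by exact: dl.
  by apply/funext => x; rewrite -TfE.
have Tlin : linear Tf.
  move=> c f g; apply/val_inj/funext => x; rewrite [LHS]TfE.
  rewrite -[RHS]/(c * Tf f x + Tf g x) !TfE; apply/esym/l_uniq.
  have h0 : (fun n => normc c * normc (T_ n f x - l f x) +
      normc (T_ n g x - l g x)) @ \oo --> (0 : R).
    rewrite -[0](addr0 0) -[X in _ --> X + _](mulr0 (normc c)).
    by apply: cvgD => //; apply: cvgM => //; exact: cvg_cst.
  apply: (squeeze_cvgr _ (cvg_cst 0) h0); near=> n.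
  rewrite normc_ge0/= linearP -[X in normc (X - _)]/(c * T_ n f x + T_ n g x).
  rewrite -ComplexField.Normc.normcM; apply: le_trans (normc_triangle _ _).
  by rewrite le_eqVlt; apply/orP; left; apply/eqP; congr normc; ring.
have TB : Tf \in @bounded_op R X.
  apply: (@bounded_opP _ _ _ (e_ 0%N + opnorm (T_ 0%N))) => // f.
  rewrite -[Tf f](subrK (T_ 0%N f)) mulrDl.
  apply: le_trans (l2normD _ _) _; apply: lerD; first exact: Tl.
  exact: le_opnorm.
exists (Bop TB) => n; apply: opnorm_le => // f; exact: Tl.
Unshelve. all: by end_near. Qed.

End BopComplete.

(** * Neumann series and contractivity of multiplicative functionals *)

Section CompositionNorm.
Variables (R : realType) (X : choiceType).

Lemma opnorm_bcomp (S T : bop R X) : opnorm (bcomp S T) <= opnorm S * opnorm T.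
Proof.
apply: opnorm_le => [|f]; first by rewrite mulr_ge0 ?opnorm_ge0.
apply: le_trans (le_opnorm S (T f)) _.
by rewrite -mulrA ler_wpM2l ?opnorm_ge0 ?le_opnorm.
Qed.

Lemma bcompDr (S T U : bop R X) : bcomp S (T + U) = bcomp S T + bcomp S U.
Proof. by apply/val_inj/funext => f; exact: (linearD S (T f) (U f)). Qed.

Lemma bcompNr (S T : bop R X) : bcomp S (- T) = - bcomp S T.
Proof. by apply/val_inj/funext => f; exact: (linearN S (T f)). Qed.

Lemma bcompBr (S T U : bop R X) : bcomp S (T - U) = bcomp S T - bcomp S U.
Proof. by rewrite bcompDr bcompNr. Qed.

Lemma opnorm_dist (S T : bop R X) : opnorm (S - T) = opnorm (T - S).
Proof.
by apply: (@complexI R); rewrite -!bop_normE distrC.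
Qed.

End CompositionNorm.

(** The algebra need not have a unit, so the element [b] plays the role of
    [(1 - a)^-1 - 1], the sum of all positive powers of [a]. *)
Lemma neumann_series (R : realType) (A : opAlg R) (a : A) : opnorm (oa_rep A a) < 1 ->
  exists b, b = a + oa_mul a b.
Proof.
set r := opnorm _ => r1; have r0 : 0 <= r by exact: opnorm_ge0.
pose s := fix s n : A := if n is n'.+1 then a + oa_mul a (s n') else 0.
pose T n := oa_rep A (s n); pose S := oa_rep A a.
have TS n : T n.+1 = S + bcomp S (T n) by rewrite /T /= linearD oa_repM.
pose C := r / (1 - r).
have C0 : 0 <= C by rewrite divr_ge0 // subr_ge0 ltW.
(* C is the sum of the r^n for n > 0, a bound for every partial sum. *)
have rC : r + r * C = C by rewrite /C; field; rewrite subr_eq0 gt_eqF.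
have T0 : T 0%N = 0 by rewrite /T /= linear0.
have TC m : opnorm (T m) <= C.
  elim: m => [|m IH].
    rewrite T0; apply: opnorm_le => // f.
    by rewrite -[(0 : bop R _) f]/(0 : ell2 _ _) l2norm0 mulr_ge0 ?l2norm_ge0.
  rewrite TS -rC; apply: le_trans (opnormD _ _) _; rewrite lerD2l.
  by apply: le_trans (opnorm_bcomp _ _) _; rewrite ler_wpM2l.
have Tc n m : opnorm (T (n + m)%N - T n) <= r ^+ n * C.
  elim: n => [|n IH]; first by rewrite T0 subr0 mul1r.
  rewrite addSn !TS opprD addrACA subrr add0r -bcompBr exprS -mulrA.
  by apply: le_trans (opnorm_bcomp _ _) _; rewrite ler_wpM2l.
have e0 : (fun n => r ^+ n * C) @ \oo --> (0 : R).
  rewrite -[0](mul0r C); apply: cvgM; last exact: cvg_cst.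
  by apply: cvg_expr; rewrite ger0_norm.
have [U UT] := bop_complete e0 Tc.
have UE : U = S + bcomp S U.
  apply/eqP; rewrite -subr_eq0; apply/eqP/opnorm_eq0/eqP.
  rewrite eq_le opnorm_ge0 andbT.
  have e1 : (fun n => r ^+ n.+1 * C + r * (r ^+ n * C)) @ \oo --> (0 : R).
    under eq_fun do rewrite mulrA -exprS -mulr2n -mulr_natl.
    rewrite -[0](mulr0 2); apply: cvgM; first exact: cvg_cst.
    by rewrite (@cvg_shiftS R (fun n => r ^+ n * C)).
  apply: (cvgr_to_ge e1); near=> n.
  have -> : U - (S + bcomp S U) = (U - T n.+1) + bcomp S (T n - U).
    by rewrite TS bcompBr !opprD !addrA; congr (_ - _); rewrite -addrA addNr addr0.
  apply: le_trans (opnormD _ _) _; apply: lerD; first exact: UT.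
  apply: le_trans (opnorm_bcomp _ _) _; rewrite ler_wpM2l//.
  by rewrite opnorm_dist; exact: UT.
have [b _ bU] : range (oa_rep A) U.
  apply: (@oa_closed R A) => B /nbhs_ballP[eps eps0 epsB].
  have /complex_realP[eps' epsE] : eps \is Num.real by rewrite gtr0_real.
  rewrite {}epsE /= in eps0 epsB; have {}eps0 : 0 < eps' by rewrite -ltcR.
  have [N _ hN] : \forall n \near \oo, `|0 - r ^+ n * C| < eps'.
    by move: e0 => /cvgrPdist_lt; apply.
  exists (T N); split; first by exists (s N).
  apply: epsB; rewrite -ball_normE /= bop_normE ltcR.
  apply: le_lt_trans (UT N) _; apply: le_lt_trans (hN N (leqnn N)).
  by rewrite sub0r normrN ler_norm.
exists b; apply/eqP; rewrite -subr_eq0; apply/eqP/normr0_eq0.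
by rewrite -oa_rep_norm linearB linearD oa_repM bU -/S -UE subrr normr0.
Unshelve. all: by end_near. Qed.

Section MultFunctional.
Variable R : realType.

(** If [|phi a| > |a|], rescale so that [phi a = 1]; the Neumann series turns this
    into the absurd equation [phi b = 1 + phi b]. *)
Lemma mult_functional_contractive (A : opAlg R) (phi : A -> scalars R) :
  mult_functional phi -> forall a, normc (phi a) <= opnorm (oa_rep A a).
Proof.
move=> [lin mul _] a; rewrite leNgt; apply/negP => h.
pose phiL := GRing.isLinear.Build R[i] A (scalars R) _ phi lin.
pose phi' : {linear A -> scalars R} := HB.pack phi phiL.
have pZ c x : phi (c *: x) = c * phi x := linearZ_LR phi' c x.
have pD x y : phi (x + y) = phi x + phi y := linearD phi' x y.
have p0 : 0 < normc (phi a) by apply: le_lt_trans h; exact: opnorm_ge0.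
have pa0 : phi a != 0 by apply: contraTneq p0 => ->; rewrite ComplexField.Normc.normc0 ltxx.
have [|b bE] := @neumann_series _ A ((phi a : R[i])^-1 *: a).
  rewrite linearZ/= opnormZ ComplexField.Normc.normcV.
  by rewrite mulrC ltr_pdivrMr// mul1r.
have := congr1 phi bE; rewrite pD mul pZ /= mulVf// mul1r => /eqP.
by rewrite -subr_eq0 opprD addrCA subrr addr0 oppr_eq0 oner_eq0.
Qed.

End MultFunctional.

(** * Complete contractivity of multiplicative functionals *)

Section MatrixNorm.
Variables (R : realType) (X : choiceType).
Local Notation H := (ell2 R X).

Lemma colnorm_ge0 k (x : 'I_k -> H) : 0 <= colnorm x.
Proof. exact: sqrtr_ge0. Qed.

Lemma sqr_colnorm k (x : 'I_k -> H) : colnorm x ^+ 2 = \sum_i l2norm (x i) ^+ 2.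
Proof. by rewrite sqr_sqrtr// sumr_ge0// => i _; exact: sqr_ge0. Qed.

Lemma l2norm_le_colnorm k (x : 'I_k -> H) i : l2norm (x i) <= colnorm x.
Proof.
rewrite -(@ler_pXn2r _ 2)// ?nnegrE ?l2norm_ge0 ?colnorm_ge0// sqr_colnorm.
by rewrite (bigD1 i)//= lerDl sumr_ge0// => j _; exact: sqr_ge0.
Qed.

Lemma colnormZ k (c : R[i]) (x : 'I_k -> H) :
  colnorm (fun i => c *: x i) = normc c * colnorm x.
Proof.
apply/eqP; rewrite -(@eqrXn2 _ 2)// ?mulr_ge0 ?normc_ge0 ?colnorm_ge0//.
rewrite exprMn !sqr_colnorm mulr_sumr; apply/eqP/eq_bigr => i _.
by rewrite l2normZ exprMn.
Qed.

Lemma le_mxopnorm k (a : 'M[bop R X]_k) x :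
  colnorm (mxact a x) <= mxopnorm a * colnorm x.
Proof.
have [x0|xn0] := eqVneq (colnorm x) 0.
  have xi i : x i = 0.
    apply: l2norm_eq0; apply/eqP; rewrite eq_le l2norm_ge0 andbT -x0.
    exact: l2norm_le_colnorm.
  rewrite x0 mulr0 /colnorm big1 ?sqrtr0// => i _.
  by rewrite /mxact big1 ?l2norm0 ?expr0n// => j _; rewrite xi linear0.
have xp : 0 < colnorm x by rewrite lt_def xn0 colnorm_ge0.
rewrite -ler_pdivrMr//.
have nci : normc ((colnorm x)^-1)%:C = (colnorm x)^-1.
  by rewrite /= expr0n/= addr0 sqrtr_sqr ger0_norm// invr_ge0 ltW.
apply: ub_le_sup; first exact: (mxopnorm_has_sup a).2.
exists (fun i => ((colnorm x)^-1)%:C *: x i) => /=.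
  by rewrite colnormZ nci mulVf.
rewrite [RHS]mulrC -[X in X * _]nci -colnormZ; congr colnorm; apply/funext => i.
by rewrite /mxact scaler_sumr; apply: eq_bigr => j _; rewrite linearZ.
Qed.

Lemma mxopnorm_le k (a : 'M[bop R X]_k) (C : R) : 0 <= C ->
  (forall x, colnorm (mxact a x) <= C * colnorm x) -> mxopnorm a <= C.
Proof.
move=> C0 aC; apply: ge_sup; first exact: (mxopnorm_has_sup a).1.
by move=> _ [x /= x1 <-]; apply: le_trans (aC x) _; rewrite ler_piMr.
Qed.

Lemma mxopnorm_ge0 k (a : 'M[bop R X]_k) : 0 <= mxopnorm a.
Proof.
apply: le_trans (colnorm_ge0 (mxact a (fun=> 0))) _.
apply: ub_le_sup; first exact: (mxopnorm_has_sup a).2.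
exists (fun=> 0) => //=.
by rewrite /colnorm big1 ?sqrtr0// => i _; rewrite l2norm0 expr0n.
Qed.

Lemma l2norm_sum (I : Type) (r : seq I) (F : I -> H) :
  l2norm (\sum_(i <- r) F i) <= \sum_(i <- r) l2norm (F i).
Proof.
elim/big_rec2: _ => [|i y1 y2 _ h]; first by rewrite l2norm0.
by apply: le_trans (l2normD _ _) _; rewrite lerD2l.
Qed.

End MatrixNorm.

(** By Lagrange's identity, twice the difference is a double sum of squares. *)
Lemma cauchy_schwarz_sum (R : realType) k (u v : 'I_k -> R) :
  (\sum_i u i * v i) ^+ 2 <= (\sum_i u i ^+ 2) * (\sum_i v i ^+ 2).
Proof.
rewrite -subr_ge0 -(@pmulr_rge0 _ 2)//.
have -> : 2 * ((\sum_i u i ^+ 2) * (\sum_i v i ^+ 2) - (\sum_i u i * v i) ^+ 2)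
        = \sum_i \sum_j (u i * v j - u j * v i) ^+ 2.
  set A := \sum_i u i ^+ 2; set B := \sum_i v i ^+ 2; set S := \sum_i u i * v i.
  have -> : 2 * (A * B - S ^+ 2) = A * B + B * A - (S * S + S * S) by ring.
  rewrite /A /B /S !big_distrlr /= -!big_split -sumrB; apply: eq_bigr => i _ /=.
  rewrite -!big_split -sumrB; apply: eq_bigr => j _ /=.
  by ring.
by do 2 ![apply: sumr_ge0 => ? _]; exact: sqr_ge0.
Qed.

Section MultFunctionalCC.
Variable R : realType.

Lemma l2norm_unit (f : ell2 R unit) : l2norm f = normc (f tt).
Proof.
have -> : f = f tt *: delta R tt.
  by apply/val_inj/funext => -[] /=; rewrite -[RHS]/(f tt * 1) mulr1.
by rewrite l2normZ l2norm_delta mulr1 -[(_ *: _ : ell2 R unit) tt]/(f tt * 1) mulr1.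
Qed.

Lemma conjc_mulE (z : R[i]) : conjc z * z = (normc z ^+ 2)%:C.
Proof.
case: z => a b /=; rewrite sqr_sqrtr ?addr_ge0 ?sqr_ge0//.
by apply/eqP; rewrite eq_complex /=; apply/andP; split; apply/eqP; ring.
Qed.

Lemma normc_conjc (z : R[i]) : normc (conjc z) = normc z.
Proof. by case: z => a b /=; rewrite sqrrN. Qed.

(** For [y = (phi (a i j)) x], the square of the norm of [y] is the value of [phi]
    at the element [b], the sum of the [conj (y_i) x_j a_ij].  Acting on a vector
    [f], this element applies the matrix [a] to the column [x_j f] and pairs the
    result with [y], so Cauchy-Schwarz bounds its norm by that of [a]. *)
Lemma mult_functional_cc (A : opAlg R) (phi : A -> scalars R) :
  mult_functional phi -> cc_hom phi.
Proof.
move=> hphi; have ctr := mult_functional_contractive hphi.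
have [lin mul _] := hphi; split=> // k a.
pose phiL := GRing.isLinear.Build R[i] A (scalars R) _ phi lin.
pose phi' : {linear A -> scalars R} := HB.pack phi phiL.
have pZ c u : phi (c *: u) = c * phi u := linearZ_LR phi' c u.
have pS (F : 'I_k -> A) : phi (\sum_i F i) = \sum_i phi (F i) := linear_sum phi' _ _ _.
set N := mxnorm a; apply: mxopnorm_le => [|x]; first exact: mxopnorm_ge0.
set y := mxact _ x.
have yE i : y i tt = \sum_j phi (a i j) * x j tt.
  rewrite /y /mxact.
  have h (I : Type) (r : seq I) (F : I -> ell2 R unit) :
      (\sum_(j <- r) F j) tt = \sum_(j <- r) F j tt.
    by elim/big_rec2: _ => // j y1 y2 _ <-.
  by rewrite h; apply: eq_bigr => j _; rewrite !mxE.
pose b : A := \sum_i \sum_j (conjc (y i tt) * x j tt : R[i]) *: a i j.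
have phib : phi b = (colnorm y ^+ 2)%:C.
  rewrite /b pS sqr_colnorm rmorph_sum; apply: eq_bigr => i _ /=.
  rewrite pS l2norm_unit -conjc_mulE [X in _ = _ * X]yE mulr_sumr.
  apply: eq_bigr => j _; rewrite pZ -mulrA; congr (_ * _); exact: mulrC.
have bN : opnorm (oa_rep A b) <= colnorm y * (N * colnorm x).
  apply: opnorm_le => [|f].
    by rewrite !mulr_ge0 ?colnorm_ge0 ?mxopnorm_ge0.
  pose g i : ell2 R (oa_ix A) := mxact (map_mx (oa_rep A) a) (fun j => x j tt *: f) i.
  have -> : oa_rep A b f = \sum_i conjc (y i tt) *: g i.
    have h (I : Type) (r : seq I) (F : I -> bop R (oa_ix A)) :
        (\sum_(j <- r) F j) f = \sum_(j <- r) F j f.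
      by elim/big_rec2: _ => // j y1 y2 _ <-.
    rewrite /b linear_sum h; apply: eq_bigr => i _; rewrite linear_sum h scaler_sumr.
    apply: eq_bigr => j _; rewrite !linearZ !mxE /= linearZ /= scalerA.
    by [].
  apply: le_trans (l2norm_sum _ _) _.
  under eq_bigr do rewrite l2normZ normc_conjc -l2norm_unit.
  have gN : colnorm g <= N * (colnorm x * l2norm f).
    apply: le_trans (le_mxopnorm _ _) _; rewrite ler_wpM2l ?mxopnorm_ge0//.
    rewrite -(@ler_pXn2r _ 2)// ?nnegrE ?mulr_ge0 ?l2norm_ge0 ?colnorm_ge0//.
    rewrite exprMn !sqr_colnorm mulr_suml; apply: ler_sum => j _.
    by rewrite l2normZ exprMn l2norm_unit.
  apply: (@le_trans _ _ (colnorm y * colnorm g)); last first.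
    by rewrite -!mulrA ler_wpM2l ?colnorm_ge0.
  rewrite -(@ler_pXn2r _ 2)// ?nnegrE ?mulr_ge0 ?colnorm_ge0//; last first.
    by apply: sumr_ge0 => i _; rewrite mulr_ge0 ?l2norm_ge0.
  by rewrite exprMn !sqr_colnorm; exact: cauchy_schwarz_sum.
have := le_trans (ctr b) bN; rewrite phib /= expr0n/= addr0 sqrtr_sqr.
rewrite ger0_norm ?sqr_ge0// expr2.
have [->|yn0] := eqVneq (colnorm y) 0.
  by rewrite mulr_ge0 ?colnorm_ge0 ?mxopnorm_ge0.
by rewrite ler_pM2l// lt_def yn0 colnorm_ge0.
Qed.

End MultFunctionalCC.

(** * Restriction and extension by zero along an injection *)

Section InverseOption.
Variables (A B : Type) (m : A -> B).
Hypothesis m_inj : injective m.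

(** The partial inverse of [m], by choice, so that operators can be defined by
    cases on the range of [m]. *)
Definition inv_opt (b : B) : option A :=
  if pselect (exists a, m a = b) is left h then Some (sval (cid h)) else None.

Lemma inv_optK a : inv_opt (m a) = Some a.
Proof.
rewrite /inv_opt; case: pselect => [h|[]]; last by exists a.
by congr Some; apply: m_inj; exact: svalP (cid h).
Qed.

Lemma inv_optN b : ~ range m b -> inv_opt b = None.
Proof.
by move=> bm; rewrite /inv_opt; case: pselect => // -[a ab]; case: bm; exists a.
Qed.

End InverseOption.

Section EsumInjective.
Variables (R : realType) (A B : choiceType) (m : A -> B).
Hypothesis m_inj : injective m.

Lemma esum_inj_le (h : B -> \bar R) : (forall b, (0 <= h b)%E) ->
  (\esum_(a in setT) h (m a) <= \esum_(b in setT) h b)%E.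
Proof.
move=> h0; rewrite -(esum_image setT m h); last by move=> x y _ _ /m_inj.
by rewrite esum_mkcond; apply: le_esum => b _; case: ifP.
Qed.

Lemma esum_inj_eq (h : B -> \bar R) : (forall b, ~ range m b -> h b = 0%E) ->
  (\esum_(b in setT) h b = \esum_(a in setT) h (m a))%E.
Proof.
move=> h0; rewrite -(esum_image setT m h); last by move=> x y _ _ /m_inj.
rewrite [RHS]esum_mkcond; apply: eq_esum => b _.
by case: ifPn => // bm; apply: h0 => hb; case/negP: bm; exact: mem_set.
Qed.

Lemma restr_subproof (f : ell2 R B) : (fun a => f (m a)) \in @sqsummable R A.
Proof.
apply/asboolP; apply: le_lt_trans (_ : sqsum f < +oo)%E.
  by apply: (esum_inj_le (h := fun b => (normc (f b) ^+ 2)%:E)) => b; rewrite lee_fin sqr_ge0.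
by case: f => f /= /asboolP.
Qed.

Definition restr (f : ell2 R B) : ell2 R A := Ell2 (restr_subproof f).

Lemma sqsum_restr f : (sqsum (restr f) <= sqsum f)%E.
Proof.
by apply: (esum_inj_le (h := fun b => (normc (f b) ^+ 2)%:E)) => b; rewrite lee_fin sqr_ge0.
Qed.

Definition extend_fun (g : A -> R[i]) (b : B) : R[i] :=
  if inv_opt m b is Some a then g a else 0.

Lemma extend_funE g a : extend_fun g (m a) = g a.
Proof. by rewrite /extend_fun inv_optK. Qed.

Lemma sqsum_extend_fun g : sqsum (extend_fun g) = sqsum g.
Proof.
rewrite /sqsum esum_inj_eq => [|b bm].
  by apply: eq_esum => a _; rewrite extend_funE.
by rewrite /extend_fun inv_optN// ComplexField.Normc.normc0 expr0n.
Qed.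

Lemma extend_subproof (g : ell2 R A) : extend_fun g \in @sqsummable R B.
Proof. by apply/asboolP; rewrite sqsum_extend_fun; case: g => g /= /asboolP. Qed.

Definition extend (g : ell2 R A) : ell2 R B := Ell2 (extend_subproof g).

End EsumInjective.

(** * Compress, then amplify *)

(** Words in [Y] label, through [j], an orthonormal family of the first space, and
    pairs [(z, y)] label, through [m], an orthonormal family of the second one,
    which is thus a multiple of the word space with multiplicity [Z], plus a
    complement. [transfer T] compresses [T] along [j], lets it act on each copy
    of the word space, and is 0 on the complement. *)
Section Transfer.
Variables (R : realType) (X1 X2 Y Z : choiceType).
Variables (j : Y -> X1) (m : Z * Y -> X2).
Hypotheses (j_inj : injective j) (m_inj : injective m).

Lemma pair_inj z : injective (fun y => m (z, y)).
Proof. by move=> y y' /m_inj[]. Qed.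

(** The component of [f] in the [z]-th copy of the word space, carried to the first
    space. *)
Definition slice (f : ell2 R X2) (z : Z) : ell2 R X1 :=
  extend j_inj (restr (@pair_inj z) f).

Lemma sliceE f z y : slice f z (j y) = f (m (z, y)).
Proof. by rewrite /= extend_funE. Qed.

Lemma sliceN f z p : ~ range j p -> slice f z p = 0.
Proof. by move=> jp; rewrite /= /extend_fun inv_optN. Qed.

Lemma slice_linear z : linear (slice^~ z).
Proof.
move=> c f g; apply/val_inj/funext => p.
rewrite -[RHS]/(c * slice f z p + slice g z p).
have [[y _ <-]|jp] := pselect (range j p); first by rewrite [LHS]sliceE !sliceE.
by rewrite [LHS]sliceN// !sliceN// mulr0 addr0.
Qed.

Lemma sqsum_prod (h : Z * Y -> R[i]) :
  sqsum h = (\esum_(z in setT) sqsum (fun y => h (z, y)))%E.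
Proof.
rewrite /sqsum (@esum_esum R Z Y setT (fun=> setT) (fun z y => (normc (h (z, y)) ^+ 2)%:E)).
  have -> : setT `*`` (fun=> setT) = [set: Z * Y] by apply/seteqP; split => [[]|[]].
  by apply: eq_esum => -[z y] _.
by move=> z y _ _; rewrite lee_fin sqr_ge0.
Qed.

Lemma esum_slice_le f : (\esum_(z in setT) sqsum (slice f z) <= sqsum f)%E.
Proof.
rewrite (eq_esum (b := fun z => sqsum (fun y => f (m (z, y))))); last first.
  by move=> z _; exact: sqsum_extend_fun.
rewrite -(sqsum_prod (fun q => f (m q))).
by apply: (esum_inj_le m_inj (h := fun b => (normc (f b) ^+ 2)%:E)) => b; rewrite lee_fin sqr_ge0.
Qed.

(** One row of the matrix of transferred operators, applied to a column. It is a
    bare function, since its square summability is what the bound below gives. *)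
Definition transfer_fun k (a : 'I_k -> bop R X1) (x : 'I_k -> ell2 R X2) :
    X2 -> R[i] :=
  extend_fun m (fun q => (\sum_l a l (slice (x l) q.1)) (j q.2)).

(** Summing over the copies [z], each of which is bounded by [C] separately;
    this treats all matrix sizes at once, and size 1 provides the boundedness
    needed to define the operator [transfer T]. *)
Lemma transfer_fun_bound k (a : 'M[bop R X1]_k) (x : 'I_k -> ell2 R X2) (C : R) :
  0 <= C -> (forall y, colnorm (mxact a y) <= C * colnorm y) ->
  (\sum_i sqsum (transfer_fun (a i) x) <= (C ^+ 2)%:E * \sum_i sqsum (x i))%E.
Proof.
move=> C0 aC.
have s0 (T : choiceType) (f : T -> R[i]) : (0 <= sqsum f)%E by exact: sqsum_ge0.
under eq_bigr do rewrite sqsum_extend_fun// sqsum_prod.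
rewrite -esum_sum//.
apply: (@le_trans _ _ (\esum_(z in setT) (C ^+ 2 * colnorm (fun l => slice (x l) z) ^+ 2)%:E)%E).
  apply: le_esum => z _.
  apply: (@le_trans _ _ (\sum_i sqsum (mxact a (fun l => slice (x l) z) i))%E).
    apply: lee_sum => i _.
    exact: (sqsum_restr j_inj (mxact a (fun l => slice (x l) z) i)).
  under eq_bigr do rewrite -l2normE.
  (* For fixed z the columns live in the first space, where C applies. *)
  rewrite sumEFin lee_fin -sqr_colnorm -exprMn.
  by rewrite ler_pXn2r ?nnegrE ?mulr_ge0 ?colnorm_ge0.
apply: le_trans (le_esumZ _ _) _; [exact: sqr_ge0|by move=> z; exact: sqr_ge0|].
rewrite lee_wpmul2l ?lee_fin ?sqr_ge0//.
under eq_esum do rewrite sqr_colnorm -sumEFin; rewrite esum_sum; last first.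
  by move=> z i _ _; rewrite lee_fin sqr_ge0.
apply: lee_sum => i _; under eq_esum do rewrite l2normE.
exact: esum_slice_le.
Qed.

Section TransferOperator.
Variable T : bop R X1.

Definition transfer_raw (f : ell2 R X2) : X2 -> R[i] :=
  extend_fun m (fun q => T (slice f q.1) (j q.2)).

Lemma transfer_raw_bound f :
  (sqsum (transfer_raw f) <= (opnorm T ^+ 2)%:E * sqsum f)%E.
Proof.
have := @transfer_fun_bound 1 (const_mx T) (fun=> f) (opnorm T) (opnorm_ge0 T).
rewrite !big_ord1.
have -> : transfer_fun ((const_mx T : 'M[bop R X1]_1) ord0) (fun=> f) = transfer_raw f.
  rewrite /transfer_raw /transfer_fun; congr extend_fun; apply/funext => q.
  by rewrite big_ord1 mxE.
apply => y; rewrite -(@ler_pXn2r _ 2)// ?nnegrE ?mulr_ge0 ?opnorm_ge0 ?colnorm_ge0//.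
rewrite exprMn !sqr_colnorm !big_ord1 /mxact big_ord1 mxE -exprMn.
by rewrite ler_pXn2r ?nnegrE ?mulr_ge0 ?opnorm_ge0 ?l2norm_ge0 ?le_opnorm.
Qed.

Lemma transfer_raw_subproof f : transfer_raw f \in @sqsummable R X2.
Proof.
apply/asboolP; apply: le_lt_trans (transfer_raw_bound f) _.
by rewrite -l2normE -EFinM ltry.
Qed.

Definition transfer_op f : ell2 R X2 := Ell2 (transfer_raw_subproof f).

Lemma transfer_opE f z y : transfer_op f (m (z, y)) = T (slice f z) (j y).
Proof. by rewrite /= /transfer_raw extend_funE. Qed.

Lemma transfer_opN f p : ~ range m p -> transfer_op f p = 0.
Proof. by move=> mp; rewrite /= /transfer_raw /extend_fun inv_optN. Qed.

Lemma transfer_bounded : transfer_op \in @bounded_op R X2.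
Proof.
apply: (@bounded_opP _ _ _ (opnorm T)).
  move=> c f g; apply/val_inj/funext => p.
  rewrite -[RHS]/(c * transfer_op f p + transfer_op g p).
  have [[[z y] _ <-]|mp] := pselect (range m p).
    by rewrite [LHS]transfer_opE !transfer_opE slice_linear linearP.
  by rewrite [LHS]transfer_opN// !transfer_opN// mulr0 addr0.
move=> f; apply: l2norm_le; first by rewrite mulr_ge0 ?opnorm_ge0 ?l2norm_ge0.
by rewrite exprMn EFinM l2normE; exact: transfer_raw_bound.
Qed.

Definition transfer : bop R X2 := Bop transfer_bounded.

Lemma transferE f z y : transfer f (m (z, y)) = T (slice f z) (j y).
Proof. exact: transfer_opE. Qed.

Lemma transferN f p : ~ range m p -> transfer f p = 0.
Proof. exact: transfer_opN. Qed.

End TransferOperator.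

Lemma transfer_linear : linear transfer.
Proof.
move=> c S T; apply/val_inj/funext => f; apply/val_inj/funext => p.
rewrite -[RHS]/(c * transfer S f p + transfer T f p).
have [[[z y] _ <-]|mp] := pselect (range m p); last first.
  by rewrite [LHS]transferN// !transferN// mulr0 addr0.
by rewrite [LHS]transferE !transferE.
Qed.

Lemma transfer_cc k (a : 'M[bop R X1]_k) :
  mxopnorm (map_mx transfer a) <= mxopnorm a.
Proof.
apply: mxopnorm_le => [|x]; first exact: mxopnorm_ge0.
rewrite -(@ler_pXn2r _ 2)// ?nnegrE ?mulr_ge0 ?mxopnorm_ge0 ?colnorm_ge0//.
rewrite exprMn !sqr_colnorm -lee_fin EFinM -!sumEFin.
under eq_bigr do rewrite l2normE.
under [X in (_ <= _ * X)%E]eq_bigr do rewrite l2normE.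
apply: le_trans (transfer_fun_bound x (mxopnorm_ge0 a) (le_mxopnorm a)).
apply: lee_sum => i _; rewrite le_eqVlt; apply/orP; left; apply/eqP; congr sqsum.
have sumE (W : choiceType) (F : 'I_k -> ell2 R W) p : (\sum_l F l) p = \sum_l F l p.
  by elim/big_rec2: _ => // l y1 y2 _ <-.
apply/funext => p; rewrite /mxact sumE.
have [[[z y] _ <-]|mp] := pselect (range m p).
  rewrite /transfer_fun extend_funE// sumE; apply: eq_bigr => l _.
  by rewrite mxE transferE.
rewrite /transfer_fun /extend_fun inv_optN// big1// => l _.
by rewrite mxE transferN.
Qed.

Lemma opnorm_transfer T : opnorm (transfer T) <= opnorm T.
Proof.
apply: opnorm_le => [|f]; first exact: opnorm_ge0.
apply: l2norm_le; first by rewrite mulr_ge0 ?opnorm_ge0 ?l2norm_ge0.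
by rewrite exprMn EFinM l2normE; exact: transfer_raw_bound.
Qed.

(** The orthogonal complement of the span of the range of [j] is invariant
    under [T]; this is what makes the compression multiplicative. *)
Definition coinvariant (T : bop R X1) :=
  forall f : ell2 R X1, (forall y, f (j y) = 0) -> forall y, T f (j y) = 0.

Lemma transfer_mul S T : coinvariant S ->
  transfer (bcomp S T) = bcomp (transfer S) (transfer T).
Proof.
move=> Sco; apply/val_inj/funext => f; apply/val_inj/funext => p.
rewrite -[RHS]/(transfer S (transfer T f) p).
have [[[z y] _ <-]|mp] := pselect (range m p); last by rewrite [LHS]transferN// transferN.
rewrite [LHS]transferE transferE -[bcomp S T _]/(S (T (slice f z))).
(* The two vectors that S receives agree on the range of j, and so do
   their images, by coinvariance. *)
apply/eqP; rewrite -subr_eq0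
  -[X in X == 0]/((S (T (slice f z)) - S (slice (transfer T f) z)) (j y)).
rewrite -linearB; apply/eqP/Sco => y'.
rewrite -[LHS]/(T (slice f z) (j y') - slice (transfer T f) z (j y')).
by rewrite sliceE transferE subrr.
Qed.

End Transfer.

(** * Paths preceded by a word in loops *)

Section LoopWords.
Variables (R : realType) (Q : digraph) (v : vert Q) (I : choiceType).
Variable e : I -> edge Q.
Hypothesis e_inj : injective e.
Hypothesis e_src : forall i, gsource (e i) = v.
Hypothesis e_rng : forall i, grange (e i) = v.

Definition starts_with_loop (es : seq (edge Q)) : bool :=
  if es is d :: _ then `[< range e d >] else false.

(** Paths with range [v] that do not start with one of the loops [e i]: the
    multiplicity space of the decomposition. *)
Definition tail := {z : gpath Q |
  (path_range z == v) && ~~ starts_with_loop (val z).1}.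

Definition prepend_raw (q : tail * seq I) : seq (edge Q) * vert Q :=
  (map e q.2 ++ (val (val q.1)).1, (val (val q.1)).2).

Lemma range_prepend_raw q : range_of (prepend_raw q) = v.
Proof.
case: q => z [|i w]; last exact: e_rng.
by have /andP[/eqP zv _] := valP z; rewrite -[RHS]zv.
Qed.

Lemma prepend_subproof q : composable (prepend_raw q).1 (prepend_raw q).2.
Proof.
case: q => z; elim=> [|i w IH] /=; first exact: valP (val z).
rewrite IH andbT e_src; apply/eqP/esym; exact: (range_prepend_raw (z, w)).
Qed.

Definition prepend (q : tail * seq I) : gpath Q :=
  exist _ (prepend_raw q) (prepend_subproof q).

Lemma range_prepend q : path_range (prepend q) = v.
Proof. exact: range_prepend_raw. Qed.

Lemma prepend_inj : injective prepend.
Proof.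
move=> [z w] [z' w'] /(congr1 val) /= [].
elim: w w' => [|i w IH] [|i' w'] /=.
- move=> h1 h2; congr (_, _); apply/val_inj/val_inj.
  by rewrite (surjective_pairing (val (val z))) h1 h2 -surjective_pairing.
- by move=> h; have /andP[_] := valP z; rewrite h /= => /asboolP[]; exists i'.
- by move=> h; have /andP[_] := valP z'; rewrite -h /= => /asboolP[]; exists i.
- by move=> [/e_inj -> h1] h2; have [-> ->] := IH _ h1 h2.
Qed.

(** The word is the longest prefix of [p] made of loops [e i]; what remains has
    range [v] since these loops have source [v]. *)
Lemma prepend_surj (p : gpath Q) : path_range p = v -> range prepend p.
Proof.
case: p => -[es x]; elim: es => [|d es IH] /= pc pv.
  have zP : (path_range (exist _ ([::], x) pc : gpath Q) == v)
      && ~~ starts_with_loop [::] by rewrite pv eqxx.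
  by exists (exist _ (exist _ ([::], x) pc) zP, [::]) => //; exact: val_inj.
have [[i _ di]|nd] := pselect (range e d); last first.
  have zP : (path_range (exist _ (d :: es, x) pc : gpath Q) == v)
      && ~~ starts_with_loop (d :: es) by rewrite pv eqxx /=; apply/asboolP.
  by exists (exist _ (exist _ (d :: es, x) pc) zP, [::]) => //; exact: val_inj.
have /andP[/eqP ds esc] := pc.
have [|[z w] _ /(congr1 val) /= zw] := IH esc.
  by rewrite -[LHS]/(range_of (es, x)) -ds -di e_src.
exists (z, i :: w) => //; apply: val_inj; rewrite /= -di.
by case: zw => <- <-.
Qed.

Definition vertex_path : gpath Q := exist _ ([::], v) isT.

Lemma vertex_tail_subproof :
  (path_range vertex_path == v) && ~~ starts_with_loop (val vertex_path).1.
Proof. by rewrite /= eqxx. Qed.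

Definition vertex_tail : tail := exist _ vertex_path vertex_tail_subproof.

Definition loop_word (w : seq I) : gpath Q := prepend (vertex_tail, w).

Lemma loop_word_inj : injective loop_word.
Proof. by move=> w w' /prepend_inj[]. Qed.

Implicit Types (d : edge Q) (f : ell2 R (gpath Q)).

Lemma LopE d f p :
  Lop R d f p = if path_strip d p is Some u then f u else 0.
Proof. by []. Qed.

Lemma PopE u f p :
  Pop R u f p = if path_range p == u then f p else 0.
Proof. by rewrite /= /pullback /P_dom; case: eqP. Qed.

Lemma Lop_prepend_cons d f z i w :
  Lop R d f (prepend (z, i :: w)) = if d == e i then f (prepend (z, w)) else 0.
Proof.
rewrite LopE; case: eqP => [->|dei].
  suff -> : path_strip (e i) (prepend (z, i :: w)) = Some (prepend (z, w)) by [].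
  apply/path_stripP; rewrite /path_cons.
  by rewrite -[X in insub X]/(val (prepend (z, i :: w))) valK.
by rewrite /path_strip /=; case: eqP => // /esym.
Qed.

Lemma Lop_prepend_nil i f z : Lop R (e i) f (prepend (z, [::])) = 0.
Proof.
rewrite LopE /path_strip /=; have /andP[_] := valP z.
case: (val (val z)).1 => [//|d es] /= /asboolP nd.
by case: eqP => // di; case: nd; exists i.
Qed.

Lemma Lop_vertex d f : Lop R d f (loop_word [::]) = 0.
Proof. by []. Qed.

Lemma Lop_range d f p : path_range p <> grange d -> Lop R d f p = 0.
Proof.
rewrite LopE /path_strip /path_range; case: (val p) => -[|d' es] x //=.
by case: eqP => // ->.
Qed.

End LoopWords.

(** * Continuity, closed sets and density *)

Section Topology.
Variable R : realType.

Lemma linear_fun0 (V W : lmodType R[i]) (f : V -> W) : linear f -> f 0 = 0.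
Proof. by move=> fl; have := fl (-1) 0 0; rewrite scaler0 addr0 scaleN1r addNr. Qed.

Lemma bounded_linear_cts (V W : normedModType R[i]) (f : V -> W) (M : R) :
  linear f -> (forall x, `|f x| <= M%:C * `|x|) -> continuous f.
Proof.
move=> fl fM.
pose f' := GRing.isLinear.Build R[i] V W _ f fl.
pose fL : {linear V -> W} := HB.pack f f'.
apply: (bounded_linear_continuous (f := fL)); apply/linear_boundedP.
exists M%:C; split; first by apply/complex_realP; exists M.
by move=> r Mr x; apply: le_trans (fM x) _; rewrite ler_wpM2r// ltW.
Qed.

Lemma closed_agree (V W : normedModType R[i]) (f g : V -> W) :
  continuous f -> continuous g -> closed [set x | f x = g x].
Proof.
move=> fc gc.
have -> : [set x | f x = g x] = (fun x => f x - g x) @^-1` [set 0].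
  by apply/seteqP; split => x /=; [move->; rewrite subrr|move=> /subr0_eq].
apply: preimage_closed => [x _|].
  by apply: (@cvgB _ _ _ (nbhs x) _ f g); [exact: fc|exact: gc].
exact/accessible_closed_set1/hausdorff_accessible/norm_hausdorff.
Qed.

Lemma coord_cts (X : choiceType) (f : ell2 R X) (x : X) :
  continuous (fun T : bop R X => T f x : R[i]^o).
Proof.
apply: (@bounded_linear_cts _ R[i]^o _ (l2norm f)); first by [].
move=> T; rewrite bop_normE -rmorphM lecR mulrC.
exact: le_trans (normc_le_l2norm _ _) (le_opnorm _ _).
Qed.

Lemma subalgP (X : choiceType) (S : closedSubalg R X) (a : subalg S) :
  cs_set S (sa_val a).
Proof. by case: a => a /= /asboolP. Qed.

Lemma closed_alg_gen_incl (X : choiceType) (G : set (bop R X)) :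
  G `<=` cs_set (closed_alg_gen G).
Proof. exact: sub_gen_smallest. Qed.

(** In the product case one factor may be assumed in the algebra, because the
    transfer is multiplicative only there. *)
Lemma closed_alg_gen_ind (X : choiceType) (G P : set (bop R X)) :
  closed P -> P 0 ->
  (forall c a b, P a -> P b -> P (c *: a + b)) ->
  (forall a b, cs_set (closed_alg_gen G) a -> P a -> P b -> P (bcomp a b)) ->
  G `<=` P -> cs_set (closed_alg_gen G) `<=` P.
Proof.
move=> Pc P0 PD PM GP a Ga.
have [Gc G0 GD GM] := cs_closed (closed_alg_gen G).
pose S := cs_set (closed_alg_gen G) `&` P.
suff [] : S a by [].
apply: Ga; split; last by move=> b Gb; split; [exact: closed_alg_gen_incl|exact: GP].
split; first exact: closedI.
- by split.
- by move=> c x y [Gx Px] [Gy Py]; split; [exact: GD|exact: PD].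
- by move=> x y [Gx Px] [Gy Py]; split; [exact: GM|exact: PM].
Qed.

(** The same principle for properties of elements of the algebra; closedness
    refers to the algebra, which has the norm of the operators. *)
Lemma subalg_gen_ind (X : choiceType) (G : set (bop R X))
    (P : set (subalg (closed_alg_gen G))) :
  closed P -> P 0 ->
  (forall c a b, P a -> P b -> P (c *: a + b)) ->
  (forall a b, P a -> P b -> P (sa_mul a b)) ->
  (forall a, G (sa_val a) -> P a) -> forall a, P a.
Proof.
move=> Pc P0 PD PM GP a.
have [Gc G0 GD GM] := cs_closed (closed_alg_gen G).
suff h : cs_set (closed_alg_gen G) `<=` [set sa_val b | b in P].
  have /h[a' Pa' /val_inj <-] // : cs_set (closed_alg_gen G) (sa_val a).
  exact: subalgP.
move=> b Gb; apply: Gb; split; last first.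
  move=> c Gc'; have cS : c \in in_subalg (closed_alg_gen G).
    by apply/asboolP; exact: closed_alg_gen_incl.
  by exists (SubAlg cS) => //; exact: GP.
split=> {b}.
- move=> b bcl.
  have Gb : cs_set (closed_alg_gen G) b.
    apply: Gc => B /bcl[_ [[c Pc' <-] Bc]]; exists (sa_val c); split => //.
    exact: subalgP.
  have bS : b \in in_subalg (closed_alg_gen G) by exact/asboolP.
  exists (SubAlg bS) => //; apply: Pc => B /nbhs_ballP[eps eps0 epsB].
  have [_ [[c Pc' <-] Bc]] := bcl _ (nbhsx_ballx b eps eps0).
  exists c; split => //; apply: epsB.
  by move: Bc; rewrite -!ball_normE.
- by exists 0.
- move=> c _ _ [x Px <-] [y Py <-]; exists (c *: x + y) => //; exact: PD.
- move=> _ _ [x Px <-] [y Py <-]; exists (sa_mul x y) => //; exact: PM.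
Qed.

End Topology.

(** * Relations between the generators *)

Section Relations.
Variables (R : realType) (Q : digraph).

Lemma Pop_mul (u w : vert Q) :
  bcomp (Pop R u) (Pop R w) = if u == w then Pop R u else 0.
Proof.
apply/val_inj/funext => f; apply/val_inj/funext => p.
rewrite -[LHS]/(Pop R u (Pop R w f) p) !PopE.
have [->|uw] := eqVneq u w; first by rewrite [RHS]PopE; case: eqP.
by case: eqP => // ->; rewrite (negbTE uw).
Qed.

Lemma Pop_Lop (d : edge Q) : bcomp (Pop R (grange d)) (Lop R d) = Lop R d.
Proof.
apply/val_inj/funext => f; apply/val_inj/funext => p.
rewrite -[LHS]/(Pop R (grange d) (Lop R d f) p) PopE.
by case: eqP => // pd; rewrite [RHS]Lop_range.
Qed.

Lemma Lop_Pop (d : edge Q) : bcomp (Lop R d) (Pop R (gsource d)) = Lop R d.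
Proof.
apply/val_inj/funext => f; apply/val_inj/funext => p.
rewrite -[LHS]/(Lop R d (Pop R (gsource d) f) p) LopE [RHS]LopE.
case dp : (path_strip d p) => [u|//]; rewrite PopE eq_sym -path_consE.
by move/path_stripP: dp => ->.
Qed.

Local Notation T := (toeplitz_alg R Q).

Lemma Pgen_subproof u : Pop R u \in in_subalg (closed_alg_gen (@toeplitz_gens R Q)).
Proof. by apply/asboolP; apply: closed_alg_gen_incl; left; exists u. Qed.
Definition Pgen u : T := SubAlg (Pgen_subproof u).

Lemma Lgen_subproof d : Lop R d \in in_subalg (closed_alg_gen (@toeplitz_gens R Q)).
Proof. by apply/asboolP; apply: closed_alg_gen_incl; right; exists d. Qed.
Definition Lgen d : T := SubAlg (Lgen_subproof d).

Lemma Pgen_idem u : oa_mul (Pgen u) (Pgen u) = Pgen u.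
Proof. by apply: val_inj; rewrite /= Pop_mul eqxx. Qed.

Lemma Pgen_Lgen d : oa_mul (Pgen (grange d)) (Lgen d) = Lgen d.
Proof. by apply: val_inj; exact: Pop_Lop. Qed.

Lemma Lgen_Pgen d : oa_mul (Lgen d) (Pgen (gsource d)) = Lgen d.
Proof. by apply: val_inj; exact: Lop_Pop. Qed.

(** Closedness is the density step: a closed property stable under the operations
    need only be checked on the generators. *)
Lemma toeplitz_ind (P : set T) :
  closed P -> P 0 ->
  (forall c a b, P a -> P b -> P (c *: a + b)) ->
  (forall a b, P a -> P b -> P (oa_mul a b)) ->
  (forall u, P (Pgen u)) -> (forall d, P (Lgen d)) -> forall a, P a.
Proof.
move=> Pc P0 PD PM PP PL; apply: subalg_gen_ind => // a [[u _ ua]|[d _ da]].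
  by suff -> : a = Pgen u by []; exact: val_inj.
by suff -> : a = Lgen d by []; exact: val_inj.
Qed.

End Relations.

(** * The transfer homomorphism between path algebras *)

Section TransferHom.
Variables (R : realType) (I : choiceType) (Q1 Q2 : digraph).
Variables (v1 : vert Q1) (e1 : I -> edge Q1).
Hypotheses (e1_inj : injective e1) (e1_src : forall i, gsource (e1 i) = v1)
  (e1_rng : forall i, grange (e1 i) = v1).
Variables (v2 : vert Q2) (e2 : I -> edge Q2).
Hypotheses (e2_inj : injective e2) (e2_src : forall i, gsource (e2 i) = v2)
  (e2_rng : forall i, grange (e2 i) = v2).

Let j := loop_word e1_src e1_rng.
Let j_inj : injective j := @loop_word_inj _ _ _ _ e1_inj e1_src e1_rng.
Let m := prepend e2_src e2_rng.
Let m_inj : injective m := @prepend_inj _ _ _ _ e2_inj e2_src e2_rng.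
Let Phi : bop R (gpath Q1) -> bop R (gpath Q2) := transfer j_inj m_inj.

(** By [prepend_surj] the pairs [m (z, w)] are exactly the paths with range [v2],
    so it suffices to compare the two operators there. *)
Lemma transfer_ext (T : bop R (gpath Q1)) (U : bop R (gpath Q2)) :
  (forall f z w, T (slice j_inj m_inj f z) (j w) = U f (m (z, w))) ->
  (forall f p, path_range p <> v2 -> U f p = 0) -> Phi T = U.
Proof.
move=> h1 h2; apply/val_inj/funext => f; apply/val_inj/funext => p.
have [[[z w] _ <-]|mp] := pselect (range m p).
  by rewrite [LHS]transferE; exact: h1.
rewrite [LHS]transferN//; apply/esym/h2 => pv; apply: mp; exact: prepend_surj.
Qed.

Lemma transfer_Pop u : Phi (Pop R u) = if u == v1 then Pop R v2 else 0.
Proof.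
apply: transfer_ext => [f z w|f p pv]; last first.
  by case: ifP => // _; rewrite PopE; case: eqP.
rewrite PopE range_prepend eq_sym; case: eqP => // _.
by rewrite PopE range_prepend eqxx sliceE.
Qed.

Lemma transfer_Lop i : Phi (Lop R (e1 i)) = Lop R (e2 i).
Proof.
apply: transfer_ext => [f z [|i' w]|f p pv]; last by apply: Lop_range; rewrite e2_rng.
  by rewrite Lop_vertex Lop_prepend_nil.
rewrite !Lop_prepend_cons (inj_eq e1_inj) (inj_eq e2_inj); case: eqP => // _.
exact: sliceE.
Qed.

Lemma transfer_Lop0 d : ~ range e1 d -> Phi (Lop R d) = 0.
Proof.
move=> nd; apply: transfer_ext => // f z [|i w]; first by rewrite Lop_vertex.
by rewrite Lop_prepend_cons; case: eqP => // di; case: nd; exists i.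
Qed.

(** Adding an edge in front of a path that is not a word in the loops never
    yields such a word. *)
Lemma toeplitz_coinvariant T :
  cs_set (closed_alg_gen (@toeplitz_gens R Q1)) T -> coinvariant j T.
Proof.
move: T; apply: closed_alg_gen_ind.
- have -> : coinvariant j = \bigcap_(f in [set f : ell2 R (gpath Q1) | forall w, f (j w) = 0])
      \bigcap_(w in setT) [set T : bop R _ | T f (j w) = 0 :> R[i]^o].
    apply/seteqP; split => T h; first by move=> f fj w _; exact: h.
    by move=> f fj w; exact: (h f fj w).
  apply: closed_bigI => f _; apply: closed_bigI => w _.
  by apply: closed_agree; [exact: coord_cts|exact: cst_continuous].
- by [].
- move=> c S T hS hT f fj w.
  by rewrite -[LHS]/(c * S f (j w) + T f (j w)) hS// hT// mulr0 addr0.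
- by move=> S T _ hS hT f fj w; apply: hS => w'; exact: hT.
- move=> _ [[u _ <-]|[d _ <-]] f fj w; first by rewrite PopE fj if_same.
  case: w => [|i w]; first by rewrite Lop_vertex.
  by rewrite Lop_prepend_cons; case: eqP => // _; exact: fj.
Qed.

Lemma transfer_cts : continuous Phi.
Proof.
apply: (@bounded_linear_cts _ _ _ _ 1); first exact: transfer_linear.
by move=> T; rewrite mul1r !bop_normE lecR; exact: opnorm_transfer.
Qed.

Lemma transfer_toeplitz T : cs_set (closed_alg_gen (@toeplitz_gens R Q1)) T ->
  cs_set (closed_alg_gen (@toeplitz_gens R Q2)) (Phi T).
Proof.
have [Sc S0 SD SM] := cs_closed (closed_alg_gen (@toeplitz_gens R Q2)).
have Phi0 : Phi 0 = 0 by apply: transfer_ext.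
move: T; apply: (@closed_alg_gen_ind _ _ _
  (Phi @^-1` cs_set (closed_alg_gen (@toeplitz_gens R Q2)))).
- by apply: preimage_closed => // T _; exact: transfer_cts.
- by rewrite /= Phi0.
- by move=> c S T hS hT; rewrite /= [Phi _]transfer_linear; exact: SD.
- move=> S T /toeplitz_coinvariant Sj hS hT.
  by rewrite /= [Phi _]transfer_mul//; exact: SM.
- move=> _ [[u _ <-]|[d _ <-]] /=.
    by rewrite transfer_Pop; case: ifP => // _; apply: closed_alg_gen_incl; left; exists v2.
  have [[i _ <-]|nd] := pselect (range e1 d); last by rewrite transfer_Lop0.
  by rewrite transfer_Lop; apply: closed_alg_gen_incl; right; exists (e2 i).
Qed.

Lemma toeplitz_transfer_subproof (a : toeplitz_alg R Q1) :
  Phi (sa_val a) \in in_subalg (closed_alg_gen (@toeplitz_gens R Q2)).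
Proof.
apply/asboolP; apply: transfer_toeplitz.
exact: (@subalgP R _ (closed_alg_gen (@toeplitz_gens R Q1)) a).
Qed.

Definition toeplitz_transfer (a : toeplitz_alg R Q1) : toeplitz_alg R Q2 :=
  SubAlg (toeplitz_transfer_subproof a).

Lemma toeplitz_transfer_cc : cc_hom toeplitz_transfer.
Proof.
split.
- by move=> c a b; apply/val_inj; exact: transfer_linear.
- move=> a b; apply/val_inj; apply: transfer_mul.
  by apply: toeplitz_coinvariant; exact: (@subalgP R _ (closed_alg_gen (@toeplitz_gens R Q1)) a).
- move=> k a; rewrite /mxnorm -!map_mx_comp.
  have -> : map_mx (oa_rep (toeplitz_alg R Q2) \o toeplitz_transfer) a =
      map_mx Phi (map_mx (oa_rep (toeplitz_alg R Q1)) a).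
    by apply/matrixP => i l; rewrite !mxE.
  exact: transfer_cc.
Qed.

Lemma toeplitz_transfer_cts : continuous toeplitz_transfer.
Proof.
apply: (@bounded_linear_cts _ _ _ _ 1); first by case: toeplitz_transfer_cc.
by move=> a; rewrite mul1r; rewrite -!oa_rep_norm !bop_normE lecR; exact: opnorm_transfer.
Qed.

Lemma toeplitz_transfer_Pgen u : toeplitz_transfer (Pgen R u) = if u == v1 then Pgen R v2 else 0.
Proof. by apply: val_inj; rewrite [LHS]transfer_Pop; case: ifP. Qed.

Lemma toeplitz_transfer_Lgen i : toeplitz_transfer (Lgen R (e1 i)) = Lgen R (e2 i).
Proof. by apply: val_inj; exact: transfer_Lop. Qed.

Lemma toeplitz_transfer_Lgen0 d : ~ range e1 d -> toeplitz_transfer (Lgen R d) = 0.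
Proof. by move=> nd; apply: val_inj; exact: transfer_Lop0. Qed.

End TransferHom.

(** * Values of characters and derivations on generators *)

Section Characters.
Variables (R : realType) (Q : digraph).
Local Notation T := (toeplitz_alg R Q).
Local Notation Pgen := (@Pgen R Q).
Local Notation Lgen := (@Lgen R Q).

Variable phi : T -> scalars R.
Hypothesis hphi : mult_functional phi.

Lemma mult_functionalM a b : phi (oa_mul a b) = (phi a : R[i]) * phi b.
Proof. by case: hphi. Qed.

Lemma mult_functional_cts : continuous phi.
Proof.
have [lin _ _] := hphi.
apply: (@bounded_linear_cts _ _ _ _ 1) => // a.
rewrite mul1r -(oa_rep_norm a) bop_normE.
rewrite -[X in X <= _]/((normc (phi a))%:C) lecR.
exact: mult_functional_contractive.
Qed.

Lemma mult_functional_idem p : oa_mul p p = p -> phi p = 0 \/ phi p = 1.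
Proof.
move=> pp; have /eqP : (phi p : R[i]) * phi p = phi p by rewrite -mult_functionalM pp.
rewrite -subr_eq0 -{3}[phi p]mulr1 -mulrBr mulf_eq0 subr_eq0.
by case/orP => /eqP; [left|right].
Qed.

(** Otherwise [phi] would vanish on every [P_u], hence on [L_d = P_(r(d)) L_d], and
    then everywhere by density. *)
Lemma mult_functional_vertex : exists v, phi (Pgen v) = 1.
Proof.
have [lin mul [a pa]] := hphi.
apply: contrapT => nv; move/eqP: pa; apply.
have P0 u : phi (Pgen u) = 0.
  by have [//|u1] := mult_functional_idem (Pgen_idem R u); case: nv; exists u.
move: a; apply: toeplitz_ind => //.
- apply: closed_agree; [exact: mult_functional_cts|exact: cst_continuous].
- exact: linear_fun0.
- by move=> c a b pa pb; rewrite /= lin pa pb scaler0 addr0.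
- by move=> a b pa pb; rewrite /= mult_functionalM pa mul0r.
- by move=> d; rewrite /= -Pgen_Lgen mult_functionalM P0 mul0r.
Qed.

Variable v : vert Q.
Hypothesis phi_v : phi (Pgen v) = 1.

Lemma mult_functional_Pgen0 u : u != v -> phi (Pgen u) = 0.
Proof.
move=> uv; have : oa_mul (Pgen u) (Pgen v) = 0.
  by apply: val_inj; rewrite /= Pop_mul (negbTE uv).
move/(congr1 phi); rewrite mult_functionalM phi_v mulr1 => ->.
by apply: linear_fun0; case: hphi.
Qed.

Definition loop_at (d : edge Q) := (gsource d == v) && (grange d == v).

Lemma mult_functional_Lgen0 d : ~~ loop_at d -> phi (Lgen d) = 0.
Proof.
rewrite /loop_at negb_and => /orP[dv|dv].
  by rewrite -Lgen_Pgen mult_functionalM mult_functional_Pgen0// mulr0.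
by rewrite -Pgen_Lgen mult_functionalM mult_functional_Pgen0// mul0r.
Qed.

Variable D : T -> scalars R.
Hypothesis hD : derivation_at phi D.

Lemma derivationM a b :
  D (oa_mul a b) = (D a : R[i]) * phi b + (phi a : R[i]) * D b.
Proof. by case: hD. Qed.

(** An idempotent [p] satisfies [D p = 2 phi(p) D p], where [phi p] is 0 or 1. *)
Lemma derivation_Pgen u : D (Pgen u) = 0.
Proof.
have := derivationM (Pgen u) (Pgen u); rewrite Pgen_idem.
have [->|->] := mult_functional_idem (Pgen_idem R u); first by rewrite mulr0 mul0r addr0.
by rewrite mulr1 mul1r -[X in X = _]addr0 => /addrI.
Qed.

Lemma derivation_Lgen0 d : ~~ loop_at d -> D (Lgen d) = 0.
Proof.
rewrite /loop_at negb_and => /orP[dv|dv].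
  by rewrite -Lgen_Pgen derivationM mult_functional_Pgen0// derivation_Pgen !mulr0 addr0.
by rewrite -Pgen_Lgen derivationM mult_functional_Pgen0// derivation_Pgen !mul0r addr0.
Qed.

End Characters.

(** The maps are [iota] and [sigma], transfers in the two directions along the loops
    at the vertex where [phi] is 1; the factorisation is [phi o sigma], [D o sigma]. *)
Lemma derivation_factors_through_bouquet_infty (R : realType) (Q : digraph)
    (phi D : toeplitz_alg R Q -> scalars R) :
  countable_graph Q -> mult_functional phi -> derivation_at phi D ->
  factors_through (bouquet_alg R None) phi D.
Proof.
move=> hQ hphi hD.
have [v pv] := mult_functional_vertex hphi.
pose loops := {d : edge Q | loop_at v d}.
pose e1 (i : loops) : edge Q := val i.
have e1_inj : injective e1 by exact: val_inj.
have e1_src i : gsource (e1 i) = v by have /andP[/eqP] := valP i.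
have e1_rng i : grange (e1 i) = v by have /andP[_ /eqP] := valP i.
have [/countable_injP[c c_inj]] := hQ.2.
(* An injection of the loops is enough: the loops of the bouquet outside its
   image are killed by sigma. *)
pose e2 (i : loops) : edge (bouquet None) := c (e1 i).
have e2_inj : injective e2 by move=> x y h; apply: e1_inj; apply: c_inj h; exact: mem_set.
have e2_src i : gsource (e2 i) = tt by [].
have e2_rng i : grange (e2 i) = tt by [].
pose iota : toeplitz_alg R Q -> bouquet_alg R None :=
  @toeplitz_transfer R _ _ _ _ _ e1_inj e1_src e1_rng _ _ e2_inj e2_src e2_rng.
pose sigma : bouquet_alg R None -> toeplitz_alg R Q :=
  @toeplitz_transfer R _ _ _ _ _ e2_inj e2_src e2_rng _ _ e1_inj e1_src e1_rng.
have iota_cc : cc_hom iota by exact: toeplitz_transfer_cc.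
have sigma_cc : cc_hom sigma by exact: toeplitz_transfer_cc.
have iota_cts : continuous iota by exact: toeplitz_transfer_cts.
have sigma_cts : continuous sigma by exact: toeplitz_transfer_cts.
have [il im _] := iota_cc; have [sl sm _] := sigma_cc.
have [pl pm pn0] := hphi; have [Dl Dc Dm] := hD.
have iP u : iota (@Pgen R Q u) = if u == v then @Pgen R (bouquet None) tt else 0.
  by exact: toeplitz_transfer_Pgen.
have siv : sigma (@Pgen R (bouquet None) tt) = @Pgen R Q v by rewrite /sigma toeplitz_transfer_Pgen.
have iL i : iota (@Lgen R Q (e1 i)) = @Lgen R (bouquet None) (e2 i)
  by exact: toeplitz_transfer_Lgen.
have sL i : sigma (@Lgen R (bouquet None) (e2 i)) = @Lgen R Q (e1 i)
  by exact: toeplitz_transfer_Lgen.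
have iL0 d : ~~ loop_at v d -> iota (@Lgen R Q d) = 0.
  move=> dv; apply: toeplitz_transfer_Lgen0 => -[i _ di].
  by move: dv; rewrite /loop_at -di e1_src e1_rng eqxx.
have s0 := linear_fun0 sl.
(* Both equalities are proved together, since the Leibniz rule for D involves phi. *)
have key a : phi (sigma (iota a)) = phi a /\ D (sigma (iota a)) = D a.
  have phic := mult_functional_cts hphi.
  have sic : continuous (sigma \o iota).
    by move=> x; apply: continuous_comp; [exact: iota_cts|exact: sigma_cts].
  have phisic : continuous (phi \o (sigma \o iota)).
    by move=> x; apply: continuous_comp; [exact: sic|exact: phic].
  have Dsic : continuous (D \o (sigma \o iota)).
    by move=> x; apply: continuous_comp; [exact: sic|exact: Dc].
  move: a; apply: toeplitz_ind.
  - apply: closedI; [exact: (closed_agree phisic phic)|exact: (closed_agree Dsic Dc)].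
  - by rewrite /= (linear_fun0 il) s0.
  - by move=> k a b [pa Da] [pb Db]; rewrite /= il sl !pl !Dl pa pb Da Db.
  - by move=> a b [pa Da] [pb Db]; rewrite /= im sm !pm !Dm pa pb Da Db.
  - move=> u; rewrite /= iP; case: eqP => [->|/eqP uv]; first by rewrite siv.
    rewrite s0 (linear_fun0 pl) (linear_fun0 Dl).
    by rewrite (mult_functional_Pgen0 hphi pv)// (derivation_Pgen hphi hD).
  - move=> d /=; have [dv|dv] := boolP (loop_at v d).
      by have := iL (exist _ d dv); rewrite /e1 /= => ->; rewrite sL.
    rewrite iL0// s0 (linear_fun0 pl) (linear_fun0 Dl).
    by rewrite (mult_functional_Lgen0 hphi pv)// (derivation_Lgen0 hphi pv hD).
have phi'_mult : mult_functional (phi \o sigma).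
  split.
  - by move=> k a b; rewrite /= sl pl.
  - by move=> a b; rewrite /= sm pm.
  - by have [a pa] := pn0; exists (iota a); rewrite /= (key a).1.
exists iota, (phi \o sigma), (D \o sigma); split => //.
- exact: mult_functional_cc.
- by apply/funext => a /=; rewrite (key a).1.
- split.
  + by move=> k a b; rewrite /= sl Dl.
  + by move=> x; apply: continuous_comp; [exact: sigma_cts|exact: Dc].
  + by move=> a b; rewrite /= sm Dm.
- by apply/funext => a /=; rewrite (key a).2.
Qed.

Local Close Scope complex_scope.
Local Close Scope ring_scope.
Local Close Scope classical_set_scope.

Theorem proposition5p2 (R : realType) (Q : digraph) (hQ : countable_graph Q)
    (phi D : toeplitz_alg R Q -> scalars R)
    (hphi : mult_functional phi) (hD : derivation_at phi D) :
  exists n : option nat,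
    n <> Some 0 /\ factors_through (bouquet_alg R n) phi D.
Proof.
by exists None; split; last exact: derivation_factors_through_bouquet_infty.
Qed.
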